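(* Let $(S,d)$ be a compact metric space, let $k \ge 2$ and $1 \le j \le k$, and let $\theta \in \mathcal{P}(S)$. Suppose that for $\theta$-almost all $s \in S$ the random variable $d(s,Y)$, where $Y$ has distribution $\theta$, has a non-atomic distribution. Then for every sequence $(\theta_n)_{n \ge 1}$ in $\mathcal{P}(S)$ converging weakly to $\theta$, the distributions $\pi_{j,k}(\theta_n)$ converge weakly to $\pi_{j,k}(\theta)$ as $n \to \infty$.
   Context: $\mathcal{P}(S)$ denotes the space of Borel probability distributions on the compact metric space $(S,d)$. For $\theta \in \mathcal{P}(S)$ and integers $k \ge 2$, $1 \le j \le k$, consider the Markov chain on $S$ which moves as follows: from a state $s \in S$, draw $k$ independent samples $Y_1,\dots,Y_k$ from $\theta$ (independently of the past), and step to the $j$'th nearest of these $k$ sampled points to $s$. That is, the samples are arranged in increasing order of distance $d(s,Y_i)$, with ties broken uniformly at random, and the chain moves to the $j$'th sample in this order. It is known that for every compact metric space $S$, every $\theta \in \mathcal{P}(S)$ and every such $(j,k)$, this chain has a unique stationary distribution. This stationary distribution is denoted $\pi_{j,k}(\theta)$, so that $\pi_{j,k}$ is a mapping $\mathcal{P}(S) \to \mathcal{P}(S)$. *)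

(* Defs.v *)
From HB Require Import structures.
From mathcomp Require Import all_boot all_order all_algebra all_fingroup.
From mathcomp Require Import all_classical all_reals all_analysis.

Set Implicit Arguments.
Unset Strict Implicit.
Unset Printing Implicit Defensive.

Import Order.TTheory GRing.Theory Num.Theory.
Import numFieldNormedType.Exports.

Local Open Scope classical_set_scope.
Local Open Scope ring_scope.

(* The structure does not relate the topology to the sigma-algebra;
   [borel_space] below does. *)
#[short(type="measurableMetricType")]
HB.structure Definition MeasurableMetric (d : measure_display) (R : realType) :=
  { T of Metric R T & Measurable d T }.

Definition borel_space (d : measure_display) (R : realType)
    (S : measurableMetricType d R) : Prop :=
  @measurable d S = <<s @open S >>.

Section iid_samples.
Context (d : measure_display) (T : measurableType d) (R : realType).

Definition cons_pair (n : nat) (p : T * n.-tuple T) : n.+1.-tuple T :=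
  [tuple of p.1 :: p.2].

Lemma measurable_cons_pair n : measurable_fun [set: T * n.-tuple T] (@cons_pair n).
Proof. exact: (measurable_cons measurable_fst measurable_snd). Qed.

HB.instance Definition _ n :=
  isMeasurableFun.Build _ _ _ _ (@cons_pair n) (@measurable_cons_pair n).

(* The n-fold product measure of theta, i.e. the law of n independent samples. *)
Fixpoint iid (theta : probability T R) (n : nat) : probability (n.-tuple T) R :=
  match n with
  | 0 => \d_([tuple] : 0.-tuple T)
  | m.+1 => distribution (theta \x iid theta m)%E (@cons_pair m)
  end.

End iid_samples.

Section nearest_sample_chain.
Context (d : measure_display) (R : realType) (S : measurableMetricType d R).
Implicit Types (s : S) (theta mu : probability S R) (j k : nat).

Definition arrangement k (y : k.-tuple S) (tau : 'S_k) : k.-tuple S :=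
  [tuple tnth y (tau i) | i < k].

Definition increasing_arrangement k s (y : k.-tuple S) (tau : 'S_k) : bool :=
  sorted (fun u v => mdist s u <= mdist s v) (arrangement y tau).

(* Conditional probability, given the samples y, that the chain moves from s
   into A: with ties broken uniformly at random, all the arrangements of the
   samples in increasing order of distance to s are equally likely.
   The index j is 1-based; the default value s of nth is irrelevant for
   1 <= j <= k. *)
Definition step_given j k s (y : k.-tuple S) (A : set S) : R :=
  (\sum_(tau : 'S_k | increasing_arrangement s y tau)
      \1_A (nth s (arrangement y tau) j.-1))
  / #|[pred tau : 'S_k | increasing_arrangement s y tau]|%:R.

Definition step j k theta s (A : set S) : \bar R :=
  (\int[iid theta k]_y (step_given j s y A)%:E)%E.

Definition stationary j k theta mu : Prop :=
  forall A, measurable A -> (\int[mu]_s step j k theta s A)%E = mu A.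

(* On a compact Borel metric space, and for 2 <= k and 1 <= j <= k, the
   stationary distribution is known to exist and to be unique on measurable sets,
   so get just names it. (Values outside the measurable sets, which the
   library leaves unconstrained, do not affect integrals of measurable functions.) *)
Definition pi_jk j k theta : probability S R := get (stationary j k theta).

Definition weakly_converges (mu_ : nat -> probability S R) mu : Prop :=
  forall f : S -> R, continuous f -> bounded_fun f ->
    (\int[mu_ n]_x (f x)%:E)%E @[n --> \oo] --> (\int[mu]_x (f x)%:E)%E.

End nearest_sample_chain.

Definition nonatomic (R : realType) (nu : set R -> \bar R) : Prop :=
  forall r : R, nu [set r] = 0%E.

(* Main.v *)
(* The chain always steps to one of the k sampled points, so if theta(A) >= 1/2
   then from any state it enters A with probability at least 2^-k. Comparing a
   function h with the middle of its range, one step of the chain therefore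
   contracts the oscillation of h by the factor q = 1 - 2^-(k+1), which does not
   depend on theta. Hence the laws theta K^m of the chain started from theta
   converge uniformly on measurable sets to a stationary law, and every
   stationary law integrates h within q^m osc(h) of theta K^m, uniformly in
   theta. It is thus enough to prove that theta_n K_n^m converges weakly to
   theta K^m for each fixed m, by induction on m. The law theta K^m is absolutely
   continuous with respect to theta, so under it and k independent samples from
   theta ties almost surely do not occur; off the ties the transition mean of a
   continuous function is continuous in (state, samples), and a penalty for
   near-ties turns it into a uniformly continuous function with a small error. *)

Require Import Defs.
From HB Require Import structures.
From mathcomp Require Import all_boot all_order all_algebra all_fingroup.
From mathcomp Require Import all_classical all_reals all_analysis.
From mathcomp Require Import measurable_realfun giry.
From mathcomp Require Import ring lra.

Set Implicit Arguments.
Unset Strict Implicit.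
Unset Printing Implicit Defensive.

Import Order.TTheory GRing.Theory Num.Theory.
Import numFieldNormedType.Exports.

Local Open Scope classical_set_scope.
Local Open Scope ring_scope.

(** * Bounded measurable functions *)

Lemma measurable_forall {d : measure_display} {X : measurableType d}
    (I : finType) (P : I -> X -> bool) :
  (forall i, measurable_fun [set: X] (P i)) ->
  measurable_fun [set: X] (fun x => [forall i, P i x]).
Proof.
move=> mP; rewrite (_ : (fun x => _) = fun x => all (P^~ x) (enum I)); last first.
  apply/funext => x; apply/forallP/allP => [PI i _|PI i]; first exact: PI.
  by apply: PI; rewrite mem_enum.
elim: (enum I) => [|i r IH] /=; first exact: measurable_cst.
exact: measurable_and.
Qed.

Section bounded_measurable.
Context {d : measure_display} {T : measurableType d} {R : realType}.
Implicit Types (f g h : T -> R) (P : probability T R).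

(** Such functions are integrable against every probability measure, so real-valued integrals add,
    compare and swap without further integrability conditions. *)
Definition bounded_measurable f : Prop :=
  measurable_fun [set: T] f /\ exists M : R, forall x, `|f x| <= M.

Lemma bounded_measurable_cst (r : R) : bounded_measurable (fun _ => r).
Proof. by split; [exact: measurable_cst|exists `|r|]. Qed.

Lemma bounded_measurableD f g : bounded_measurable f -> bounded_measurable g ->
  bounded_measurable (fun x => f x + g x).
Proof.
move=> [mf [M fM]] [mg [N gN]]; split; first exact: measurable_funD.
by exists (M + N) => x; rewrite (le_trans (ler_normD _ _))// lerD.
Qed.

Lemma bounded_measurableM f g : bounded_measurable f -> bounded_measurable g ->
  bounded_measurable (fun x => f x * g x).
Proof.
move=> [mf [M fM]] [mg [N gN]]; split; first exact: measurable_funM.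
by exists (M * N) => x; rewrite normrM ler_pM.
Qed.

Lemma bounded_measurableB f g : bounded_measurable f -> bounded_measurable g ->
  bounded_measurable (fun x => f x - g x).
Proof.
move=> [mf [M fM]] [mg [N gN]]; split; first exact: measurable_funB.
by exists (M + N) => x; rewrite (le_trans (ler_normB _ _))// lerD.
Qed.

Lemma bounded_measurable_sum (I : Type) (r : seq I) (p : pred I) (F : I -> T -> R) :
  (forall i, bounded_measurable (F i)) ->
  bounded_measurable (fun x => \sum_(i <- r | p i) F i x).
Proof.
move=> bF; elim: r => [|i r IH].
  under eq_fun do rewrite big_nil; exact: bounded_measurable_cst.
under eq_fun do rewrite big_cons.
by case: (p i) => //; exact: bounded_measurableD.
Qed.

Lemma bounded_measurable_indic (A : set T) : measurable A ->
  bounded_measurable (\1_A : T -> R).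
Proof.
move=> mA; split; first exact: measurable_indic.
by exists 1 => x; rewrite indicE; case: (x \in A); rewrite ?normr1 ?normr0.
Qed.

Lemma bounded_measurable_between (a b : R) f : measurable_fun [set: T] f ->
  (forall x, a <= f x <= b) -> bounded_measurable f.
Proof.
move=> mf abf; split => //; exists (Num.max `|a| `|b|) => x.
have /andP[af fb] := abf x.
rewrite ler_norml; apply/andP; split.
  by apply: le_trans af; rewrite lerNl le_max -normrN ler_norm.
by apply: le_trans fb _; rewrite le_max ler_norm orbT.
Qed.

Lemma bounded_measurable_integrable P f : bounded_measurable f ->
  P.-integrable [set: T] (EFin \o f).
Proof.
move=> [mf [M fM]]; apply: measurable_bounded_integrable => //.
  exact: le_lt_trans (probability_le1 P measurableT) (ltry 1).
by exists M; split; [exact: num_real|move=> N MN x _; exact: le_trans (fM x) (ltW MN)].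
Qed.

Lemma EFin_Rintegral P f : bounded_measurable f ->
  (\int[P]_x f x)%:E = (\int[P]_x (f x)%:E)%E.
Proof.
move=> bf; rewrite fineK//; apply: integrable_fin_num => //.
exact: bounded_measurable_integrable.
Qed.

Lemma Rintegral_cst1 P (r : R) : \int[P]_x r = r.
Proof. by rewrite Rintegral_cst//= probability_setT mulr1. Qed.

Lemma le_Rintegral_bounded P f g :
  bounded_measurable f -> bounded_measurable g -> (forall x, f x <= g x) ->
  \int[P]_x f x <= \int[P]_x g x.
Proof.
by move=> bf bg fg; apply: le_Rintegral => //; exact: bounded_measurable_integrable.
Qed.

Lemma Rintegral_between P f (a b : R) : bounded_measurable f ->
  (forall x, a <= f x <= b) -> a <= \int[P]_x f x <= b.
Proof.
move=> bf abf; rewrite -[in X in X <= _](Rintegral_cst1 P a).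
rewrite -[in X in _ && (_ <= X)](Rintegral_cst1 P b).
by apply/andP; split; apply: le_Rintegral_bounded => //;
  try exact: bounded_measurable_cst; move=> x; case/andP: (abf x).
Qed.

Lemma RintegralB_bounded P f g : bounded_measurable f -> bounded_measurable g ->
  \int[P]_x (f x - g x) = \int[P]_x f x - \int[P]_x g x.
Proof.
by move=> bf bg; rewrite RintegralB//; exact: bounded_measurable_integrable.
Qed.

Lemma RintegralD_bounded P f g : bounded_measurable f -> bounded_measurable g ->
  \int[P]_x (f x + g x) = \int[P]_x f x + \int[P]_x g x.
Proof.
by move=> bf bg; rewrite RintegralD//; exact: bounded_measurable_integrable.
Qed.

Lemma dist_Rintegral_le P f g (e : R) :
  bounded_measurable f -> bounded_measurable g ->
  (forall x, `|f x - g x| <= e) -> `|\int[P]_x f x - \int[P]_x g x| <= e.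
Proof.
move=> bf bg fge; rewrite -RintegralB_bounded// ler_norml.
by apply: Rintegral_between; [exact: bounded_measurableB|move=> x; rewrite -ler_norml].
Qed.

Lemma Rintegral_indic P (A : set T) : measurable A -> \int[P]_x \1_A x = fine (P A).
Proof. by move=> mA; rewrite /Rintegral integral_indic// setIT. Qed.

End bounded_measurable.

Lemma bounded_measurable_comp {d d' : measure_display} {T : measurableType d}
    {T' : measurableType d'} {R : realType} (f : T' -> R) (u : T -> T') :
  bounded_measurable f -> measurable_fun [set: T] u ->
  bounded_measurable (fun x => f (u x)).
Proof.
move=> [mf [M fM]] mu; split; last by exists M.
exact: (measurableT_comp mf mu).
Qed.

(** * Fubini's theorem for bounded functions *)

Section product_mean.
Context {d d' : measure_display} {X : measurableType d} {Y : measurableType d'}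
  {R : realType} (P : probability X R) (Q : probability Y R).
Variable F : X * Y -> R.
Hypothesis bF : bounded_measurable F.

Lemma bounded_measurable_xsection x : bounded_measurable (fun y => F (x, y)).
Proof. exact: bounded_measurable_comp. Qed.

Lemma bounded_measurable_ysection y : bounded_measurable (fun x => F (x, y)).
Proof. exact: (bounded_measurable_comp bF (pair2_measurable y)). Qed.

Lemma bounded_measurable_Rintegral :
  bounded_measurable (fun x => \int[Q]_y F (x, y)).
Proof.
have [mF [M FM]] := bF; split; last first.
  exists M => x; rewrite ler_norml; apply: Rintegral_between.
    exact: bounded_measurable_xsection.
  by move=> y; rewrite -ler_norml.
apply: measurableT_comp; first exact: fine_measurable.
(* A measure on the first factor has to be supplied; a point mass serves, so that the statement
   involves [Q] only. *)
apply: (@measurable_fubini_F _ _ _ _ _ (\d_point : probability X R) Q (EFin \o F)).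
exact: bounded_measurable_integrable.
Qed.

Lemma Rintegral_prod :
  \int[(P \x Q)%E]_z F z = \int[P]_x \int[Q]_y F (x, y).
Proof.
rewrite /Rintegral -(@integral12_prod_meas1 _ _ _ _ _ P Q (EFin \o F))//; last first.
  exact: bounded_measurable_integrable.
congr fine; apply: eq_integral => x _.
exact/esym/EFin_Rintegral/bounded_measurable_xsection.
Qed.

Lemma Rintegral_Fubini :
  \int[P]_x \int[Q]_y F (x, y) = \int[Q]_y \int[P]_x F (x, y).
Proof.
rewrite -Rintegral_prod /Rintegral.
rewrite -(@integral21_prod_meas1 _ _ _ _ _ P Q (EFin \o F))//; last first.
  exact: bounded_measurable_integrable.
congr fine; apply: eq_integral => y _.
exact/esym/EFin_Rintegral/bounded_measurable_ysection.
Qed.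

End product_mean.

(** * Mixtures, finite averages and comparison of measures *)

Section kernel_bind.
Context {d d' : measure_display} {X : measurableType d} {Y : measurableType d'}
  {R : realType} (P : probability X R) (L : X -> probability Y R).
Hypothesis mL : forall A, measurable A ->
  measurable_fun [set: X] (fun x => fine (L x A)).

Let mLgiry : measurable_fun [set: X] (L : X -> giry Y R).
Proof.
apply: measurable_giry_codensity => // A mA.
rewrite (_ : (fun x => _) = EFin \o (fun x => fine (L x A))).
  by apply/measurable_EFinP; exact: mL.
by apply/funext => x /=; rewrite fineK// fin_num_measure.
Qed.

Lemma bounded_measurable_kernel (h : Y -> R) : bounded_measurable h ->
  bounded_measurable (fun x => \int[L x]_y h y).
Proof.
move=> bh; have [mh [M hM]] := bh.
split; last first.
  exists M => x; rewrite ler_norml; apply: Rintegral_between => // y.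
  by rewrite -ler_norml.
(* The shift by the bound [M] makes the integrand nonnegative, as [measurable_giry_int] requires. *)
rewrite (_ : (fun x => _) = (fun x => \int[L x]_y (h y + M) - M)); last first.
  apply/funext => x.
  rewrite RintegralD_bounded//; last exact: bounded_measurable_cst.
  by rewrite Rintegral_cst1 addrK.
apply: measurable_funB => //; apply: measurableT_comp; first exact: fine_measurable.
apply: (measurableT_comp (measurable_giry_int (f := fun y => (h y + M)%:E) _ _) mLgiry).
  by apply/measurable_EFinP; exact: measurable_funD.
by move=> y; have := hM y; rewrite lee_fin ler_norml -lerBlDr sub0r => /andP[].
Qed.

Lemma kernel_bind : exists Q : probability Y R,
  forall h : Y -> R, bounded_measurable h ->
    \int[Q]_y h y = \int[P]_x \int[L x]_y h y.
Proof.
pose Q0 := giry_bind (P : giry X R) mLgiry.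
have Q0E (h : Y -> \bar R) : measurable_fun [set: Y] h -> (forall y, 0 <= h y)%E ->
    (\int[Q0]_y h y = \int[P]_x \int[L x]_y h y)%E.
  exact: giry_int_bind.
have Q0T : Q0 [set: Y] = 1%E.
  have := Q0E (cst 1%E) (measurable_cst _) (fun=> lee01).
  rewrite integral_cst// mul1e => ->.
  under eq_integral do rewrite integral_cst//= mul1e probability_setT.
  by rewrite integral_cst//= mul1e probability_setT.
pose Q : probability Y R :=
  HB.pack_for (probability Y R) (Q0 : set Y -> \bar R) (SubProbability.class Q0)
    (isProbability.Build _ _ _ Q0 Q0T).
have QE (h : Y -> R) : bounded_measurable h -> (forall y, 0 <= h y) ->
    \int[Q]_y h y = \int[P]_x \int[L x]_y h y.
  move=> bh h0; apply/EFin_inj; rewrite !EFin_Rintegral//; last first.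
    exact: bounded_measurable_kernel.
  rewrite (Q0E (EFin \o h))//; last exact/measurable_EFinP/bh.1.
  by apply: eq_integral => x _; rewrite EFin_Rintegral.
exists Q => h bh; have [mh [M hM]] := bh.
have bM d0 (Z : measurableType d0) : bounded_measurable (fun _ : Z => M).
  exact: bounded_measurable_cst.
apply: (@addIr _ M).
have := QE (fun y => h y + M) (bounded_measurableD bh (bM _ _)).
rewrite [in RHS](_ : (fun x => _) = (fun x => \int[L x]_y h y + M)); last first.
  by apply/funext => x; rewrite RintegralD_bounded// Rintegral_cst1.
rewrite !RintegralD_bounded// ?Rintegral_cst1//; last exact: bounded_measurable_kernel.
by apply => y; have := hM y; rewrite ler_norml -lerBlDr sub0r => /andP[].
Qed.

End kernel_bind.

(** Repeated entries of [c] count with multiplicity. For given samples this realises the uniform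
    choice among the increasing arrangements. *)
Lemma empirical_measure {d : measure_display} {T : measurableType d} {R : realType}
    (c : seq T) : c != [::] ->
  exists Q : probability T R, forall h : T -> R, bounded_measurable h ->
    \int[Q]_y h y = (\sum_(x <- c) h x) / (size c)%:R.
Proof.
move=> c0.
have sc0 : (size c)%:R != 0 :> R by rewrite pnatr_eq0 size_eq0.
have r0 : 0 <= (size c)%:R^-1 :> R by rewrite invr_ge0.
pose Q0 : {measure set T -> \bar R} :=
  mscale (NngNum r0) (msum (fun i => \d_(nth point c i)) (size c)).
have Q0T : Q0 [set: T] = 1%E.
  rewrite /Q0/= /mscale/= /msum/=.
  under eq_bigr do rewrite diracT.
  by rewrite sumEFin sumr_const card_ord -EFinM mulVf.
pose Q : probability T R :=
  HB.pack_for (probability T R) (Q0 : set T -> \bar R) (Measure.class Q0)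
    (Measure_isProbability.Build _ _ _ Q0 Q0T).
have QE (h : T -> R) : bounded_measurable h -> (forall y, 0 <= h y) ->
    \int[Q]_y h y = (\sum_(x <- c) h x) / (size c)%:R.
  move=> bh h0; apply/EFin_inj; rewrite EFin_Rintegral//.
  have mh : measurable_fun [set: T] (EFin \o h) by exact/measurable_EFinP/bh.1.
  have Eh0 x : [set: T] x -> (0 <= (EFin \o h) x)%E by rewrite /= lee_fin.
  rewrite (ge0_integral_mscale _ _ _ mh Eh0)//=.
  rewrite (ge0_integral_measure_sum _ _ Eh0 mh)//.
  rewrite (eq_bigr (fun i : 'I_ _ => (h (nth point c i))%:E)); last first.
    by move=> i _; rewrite [LHS]integral_dirac// diracT mul1e.
  by rewrite sumEFin -EFinM mulrC (big_nth point) big_mkord.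
exists Q => h bh; have [mh [M hM]] := bh.
have bM : bounded_measurable (fun _ : T => M) by exact: bounded_measurable_cst.
apply: (@addIr _ M).
have := QE (fun y => h y + M) (bounded_measurableD bh bM).
rewrite RintegralD_bounded// Rintegral_cst1 big_split/= mulrDl.
rewrite big_const_seq count_predT iter_addr_0 -(mulr_natr M) mulfK//.
by apply => y; have := hM y; rewrite ler_norml -lerBlDr sub0r => /andP[].
Qed.

(* With U uniform on [0, 1], Fubini gives [\int h dP = \int P {t < h} dU(t)]. *)
Lemma dist_Rintegral_setwise {d : measure_display} {T : measurableType d}
    {R : realType} (P Q : probability T R) (e : R) :
  (forall A, measurable A -> `|fine (P A) - fine (Q A)| <= e) ->
  forall h : T -> R, measurable_fun [set: T] h -> (forall x, 0 <= h x <= 1) ->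
    `|\int[P]_x h x - \int[Q]_x h x| <= e.
Proof.
move=> PQe h mh h01.
pose U : probability (measurableTypeR R) R := uniform_prob (@ltr01 R).
have UE (r : R) : 0 <= r <= 1 -> fine (U [set t | t < r]) = r.
  move=> /andP[r0 r1].
  rewrite /U /= /uniform_prob integral_uniform_pdf.
  rewrite (_ : _ `&` _ = `[0, r[%classic); last first.
    apply/seteqP; split => t /=; rewrite !in_itv/=.
      by move=> [-> /andP[->]].
    by move=> /andP[-> tr]; rewrite tr; split => //; exact: ltW (lt_le_trans tr r1).
  rewrite (eq_integral (fun=> 1%:E)); last first.
    move=> t; rewrite inE/= in_itv/= => /andP[t0 tr].
    by rewrite /uniform_pdf t0 (ltW (lt_le_trans tr r1)) subr0 invr1.
  rewrite integral_cst//= mul1e lebesgue_measure_itv/= lte_fin.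
  case: ltP => [_|r0'] /=; first by rewrite ?subr0 ?oppr0 ?adde0 ?addr0.
  by apply/eqP; rewrite eq_le r0 r0'.
pose D : set (measurableTypeR R * T) := [set z | z.1 < h z.2].
have mD : measurable D.
  rewrite -[D]setTI.
  have : measurable_fun [set: measurableTypeR R * T] (fun z => z.1 < h z.2).
    by apply: measurable_fun_ltr => //; exact: measurableT_comp.
  by move=> /(_ measurableT [set true] I).
have bD : bounded_measurable (\1_D : _ -> R) by exact: bounded_measurable_indic.
have RE (V : probability T R) : \int[V]_x h x = \int[U]_t \int[V]_x \1_D (t, x).
  rewrite Rintegral_Fubini//; apply: eq_Rintegral => x _.
  rewrite -[LHS](UE _ (h01 x)) -Rintegral_indic//.
  rewrite -[X in measurable X]set_itvNyo; exact: measurable_itv.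
rewrite !RE; apply: dist_Rintegral_le; try exact: bounded_measurable_Rintegral.
move=> t.
have mDt : measurable (xsection D t) by exact: measurable_xsection.
have VE (V : probability T R) : \int[V]_x \1_D (t, x) = fine (V (xsection D t)).
  rewrite -Rintegral_indic//; apply: eq_Rintegral => x _.
  by rewrite !indicE mem_xsection.
by rewrite !VE; exact: PQe.
Qed.

(** * Operators contracting oscillations *)

(** The affine map from [-M, M] onto [0, 1] reduces this to functions with values in [0, 1]; its
    inverse has slope 2M. *)
Lemma dist_Rintegral_setwise_bounded {d : measure_display} {T : measurableType d}
    {R : realType} (P Q : probability T R) (e : R) :
  (forall A, measurable A -> `|fine (P A) - fine (Q A)| <= e) ->
  forall M : R, 0 < M -> forall h : T -> R, measurable_fun [set: T] h ->
    (forall x, `|h x| <= M) ->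
    `|\int[P]_x h x - \int[Q]_x h x| <= 2 * M * e.
Proof.
move=> PQe M M0 h mh hM; pose g x := (2 * M)^-1 * (h x + M).
have M2 : 0 < 2 * M by rewrite mulr_gt0.
have bh : bounded_measurable h by split => //; exists M.
have bhM : bounded_measurable (fun x => h x + M).
  by apply: bounded_measurableD => //; exact: bounded_measurable_cst.
have bg : bounded_measurable g.
  by apply: bounded_measurableM => //; exact: bounded_measurable_cst.
have gE (V : probability T R) : \int[V]_x h x = 2 * M * \int[V]_x g x - M.
  rewrite RintegralZl//; last exact: bounded_measurable_integrable.
  rewrite mulVKf ?gt_eqF// RintegralD_bounded//; last exact: bounded_measurable_cst.
  by rewrite Rintegral_cst1 addrK.
have g01 x : 0 <= g x <= 1.
  have := hM x; rewrite ler_norml => /andP[? ?].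
  rewrite /g mulr_ge0 ?invr_ge0 ?(ltW M2)//=; last lra.
  by rewrite ler_pdivrMl// mulr1; lra.
have := dist_Rintegral_setwise PQe bg.1 g01.
rewrite !gE; set x := \int[P]_x _; set y := \int[Q]_x _ => xye.
rewrite (_ : _ - _ = 2 * M * (x - y)); last by ring.
by rewrite normrM gtr0_norm// ler_pM2l.
Qed.

(** The values on each set are Cauchy, and finite additivity passes to the limit. Countable
    additivity passes too because the bound [e m] is the same for all measurable sets. *)
Lemma uniform_setwise_limit {d : measure_display} {T : measurableType d}
    {R : realType} (mu_ : nat -> probability T R) (e : nat -> R) :
  e @ \oo --> (0 : R) ->
  (forall m n A, measurable A -> (m <= n)%N ->
    `|fine (mu_ n A) - fine (mu_ m A)| <= e m) ->
  exists mu : probability T R, forall m A, measurable A ->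
    `|fine (mu A) - fine (mu_ m A)| <= e m.
Proof.
move=> e0 mue; pose a m A := fine (mu_ m A).
have ltee (r : R) : 0 < r -> \forall m \near \oo, e m < r.
  move=> r0; near=> m; rewrite (le_lt_trans (ler_norm _))//.
  by near: m; have /cvgr0Pnorm_lt := e0; apply.
have acvg A : measurable A -> cvgn (a ^~ A).
  move=> mA; apply/cauchy_cvgP/cauchy_exP => r r0.
  near \oo => m; exists (a m A).
  suff : \forall n \near \oo, ball (a m A) r (a n A) by [].
  near=> n; rewrite /ball/= distrC (le_lt_trans (mue m n A mA _))//; last first.
    by near: m; exact: ltee.
  by near: n; exists m.
pose l A := lim (a ^~ A @ \oo).
have la m A : measurable A -> `|l A - a m A| <= e m.
  move=> mA.
  have c : `|a n A - a m A| @[n --> \oo] --> `|l A - a m A|.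
    by apply: cvg_norm; apply: cvgB; [exact: acvg|exact: cvg_cst].
  rewrite -(cvg_lim _ c)//; apply: limr_le; first exact: cvgP c.
  by near=> n; apply: mue => //; near: n; exists m.
have l_ge0 A : measurable A -> 0 <= l A.
  by move=> mA; apply: limr_ge; [exact: acvg|near=> n; exact: fine_ge0].
have lE A r : (forall m, a m A = r) -> l A = r.
  move=> aE; rewrite /l (_ : a ^~ A = cst r) ?lim_cst//.
  by apply/funext => m; exact: aE.
have l_sum (F : nat -> set T) n : (forall i, measurable (F i)) -> trivIset setT F ->
    l (\big[setU/set0]_(i < n) F i) = \sum_(i < n) l (F i).
  move=> mF tF; rewrite /l; apply: cvg_lim => //.
  rewrite (_ : a ^~ _ = fun m => \sum_(i < n) a m (F i)); last first.
    apply/funext => m; rewrite /a measure_semi_additive//; last exact: bigsetU_measurable.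
    by rewrite sum_fine// => i _; rewrite fin_num_measure.
  by apply: cvg_big => [|i _]; [exact: add_continuous|exact: acvg].
(* Nonnegativity is required on all sets, but the limit is controlled only on measurable ones;
   elsewhere the value is 0. *)
pose mu A : \bar R := (if `[< measurable A >] then l A else 0)%:E.
have muE A : measurable A -> mu A = (l A)%:E by move=> mA; rewrite /mu asboolT.
have mu0 : mu set0 = 0%E.
  by rewrite muE//; congr EFin; apply: lE => m; rewrite /a measure0.
have mu_ge0 A : (0 <= mu A)%E.
  by rewrite /mu; case: asboolP => // mA; rewrite lee_fin l_ge0.
have mu_sigma : semi_sigma_additive mu.
  move=> F mF tF mUF; rewrite (muE _ mUF).
  under eq_fun do
    [rewrite big_mkord; under eq_bigr do rewrite muE//; rewrite sumEFin -l_sum//].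
  apply: cvg_EFin; first by near=> n.
  apply/cvgrPdist_le => /= r r0.
  (* Interchange of limits: [m] is fixed first with [e m <= r / 3], the countable additivity of
     [mu_ m] costs another r/3, and the exchange of [l] for [a m] is paid twice. *)
  near \oo => m.
  have em : e m <= r / 3 by rewrite ltW//; near: m; apply: ltee; rewrite divr_gt0.
  have aF : a m (\big[setU/set0]_(i < n) F i) @[n --> \oo] --> a m (\bigcup_n F n).
    have := @measure_semi_sigma_additive _ _ _ (mu_ m) F mF tF mUF.
    rewrite -[X in _ --> X]fineK ?fin_num_measure// => /fine_cvg.
    rewrite (_ : (fine \o _) = (fun n => a m (\big[setU/set0]_(i < n) F i)))//.
    apply/funext => n /=; rewrite big_mkord /a measure_semi_additive//.
    exact: bigsetU_measurable.
  have : \forall n \near \oo,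
      `|a m (\bigcup_n F n) - a m (\big[setU/set0]_(i < n) F i)| <= r / 3.
    by move/cvgrPdist_le : aF; apply; rewrite divr_gt0.
  apply: filterS => n rn.
  have mUn : measurable (\big[setU/set0]_(i < n) F i) by exact: bigsetU_measurable.
  have := la m _ mUF; have := la m _ mUn.
  move: rn em; rewrite !ler_norml => /andP[? ?] ? /andP[? ?] /andP[? ?].
  by apply/andP; split; lra.
have muT : mu [set: T] = 1%E.
  rewrite muE//; congr EFin; apply: lE => m.
  by rewrite /a /= probability_setT.
pose muM := isMeasure.Build _ _ _ mu mu0 mu_ge0 mu_sigma.
pose muX : {measure set T -> \bar R} := HB.pack_for {measure set T -> \bar R} mu muM.
pose muP : probability T R := HB.pack_for (probability T R) mu (Measure.class muX)
  (Measure_isProbability.Build _ _ _ muX muT).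
exists muP => m A mA; rewrite -[fine (muP A)]/(fine (mu A)) (muE _ mA).
exact: la.
Unshelve. all: by end_near. Qed.

(* u is a Markov kernel acting on bounded functions; [transports mu nu] below says
   that nu = mu u. *)
Section contracting_operator.
Context {d : measure_display} {T : measurableType d} {R : realType}.
Variables (u : (T -> R) -> T -> R) (q : R).
Hypothesis q01 : 0 <= q < 1.
Hypothesis bu : forall h, bounded_measurable h -> bounded_measurable (u h).
Hypothesis osc : forall h (a b : R), bounded_measurable h ->
  (forall x, a <= h x <= b) ->
  exists a' b', [/\ a <= a', b' <= b, b' - a' = q * (b - a) &
                   forall x, a' <= u h x <= b'].

Definition transports (mu nu : probability T R) :=
  forall h, bounded_measurable h -> \int[nu]_x h x = \int[mu]_x u h x.

Hypothesis transportsE : forall mu, exists nu, transports mu nu.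

Lemma bounded_measurable_iter n h : bounded_measurable h ->
  bounded_measurable (iter n u h).
Proof. by move=> bh; elim: n => //= n; exact: bu. Qed.

Lemma iter_osc n h (a b : R) : bounded_measurable h -> (forall x, a <= h x <= b) ->
  exists a' b', b' - a' = q ^+ n * (b - a) /\ forall x, a' <= iter n u h x <= b'.
Proof.
move=> bh hab; elim: n => [|n [a1 [b1 [ab1 h1]]]].
  by exists a, b; rewrite expr0 mul1r.
have [a2 [b2 [_ _ ab2 h2]]] := osc (bounded_measurable_iter n bh) h1.
by exists a2, b2; rewrite ab2 ab1 exprS mulrA.
Qed.

Lemma transports_iter (mu_ : nat -> probability T R) :
  (forall n, transports (mu_ n) (mu_ n.+1)) ->
  forall n m h, bounded_measurable h ->
    \int[mu_ (m + n)%N]_x h x = \int[mu_ m]_x iter n u h x.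
Proof.
move=> tmu n m; elim: n m => [|n IH] m h bh; first by rewrite addn0.
by rewrite addnS -addSn IH// tmu//; exact: bounded_measurable_iter.
Qed.

(** Both sides integrate [iter n u h] against the initial laws, and this function takes its values
    in an interval of length [q ^+ n * (b - a)]. *)
Lemma transports_cvg (mu_ nu_ : nat -> probability T R) n h (a b : R) :
  (forall n, transports (mu_ n) (mu_ n.+1)) ->
  (forall n, transports (nu_ n) (nu_ n.+1)) ->
  bounded_measurable h -> (forall x, a <= h x <= b) ->
  `|\int[mu_ n]_x h x - \int[nu_ n]_x h x| <= q ^+ n * (b - a).
Proof.
move=> tmu tnu bh hab; have [a' [b' [ab' hab']]] := iter_osc n bh hab.
have bn := bounded_measurable_iter n bh.
rewrite -(add0n n) !transports_iter// -ab'.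
have /andP[? ?] := Rintegral_between (mu_ 0) bn hab'.
have /andP[? ?] := Rintegral_between (nu_ 0) bn hab'.
by rewrite ler_norml; apply/andP; split; lra.
Qed.

(** The laws of the chain started from an arbitrary point are Cauchy uniformly over measurable sets.
    Their limit is invariant since [u h] is again an admissible test function. *)
Lemma transports_fixpoint : exists pi : probability T R, transports pi pi.
Proof.
have [nxt nxtE] := choice transportsE.
pose mu_ n : probability T R := iter n nxt (\d_point : probability T R).
have tmu n : transports (mu_ n) (mu_ n.+1) by exact: nxtE.
have mu_close m n A : measurable A -> (m <= n)%N ->
    `|fine (mu_ n A) - fine (mu_ m A)| <= q ^+ m.
  move=> mA mn; rewrite -!Rintegral_indic// -[leRHS]mulr1 -(subr0 1).
  rewrite -(subnK mn).
  (* Both laws result from m steps, one started from [mu_ (n - m)] and the other from [mu_ 0]. *)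
  apply: (@transports_cvg (fun i => mu_ (n - m + i)%N) mu_) => //.
  - by move=> i; rewrite addnS.
  - exact: bounded_measurable_indic.
  - by move=> x; rewrite indicE; case: (x \in A); rewrite /= ?lexx ?ler01.
have q0 : q ^+ n @[n --> \oo] --> (0 : R).
  by apply: cvg_expr; have /andP[q0 q1] := q01; rewrite ger0_norm.
have [pi piE] := uniform_setwise_limit q0 mu_close.
exists pi => h bh; have [_ [M0 hM0]] := bh.
pose M := `|M0| + 1.
have M0' : 0 < M by rewrite ltr_wpDl.
have hM x : `|h x| <= M.
  by rewrite (le_trans (hM0 x))// (le_trans (ler_norm _))// lerDl.
have [a' [b' [aM bM _ uhM]]] : exists a' b', [/\ - M <= a', b' <= M,
    b' - a' = q * (M - - M) & forall x, a' <= u h x <= b'].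
  by apply: osc => // x; rewrite -ler_norml.
have {}uhM x : `|u h x| <= M.
  rewrite ler_norml; have /andP[? ?] := uhM x.
  by apply/andP; split; [exact: le_trans aM _|exact: le_trans bM].
apply/eqP; rewrite -subr_eq0 -normr_le0; apply/ler_addgt0Pr => r r0; rewrite add0r.
near \oo => m.
(* The setwise bounds at times [m] and [m.+1] cost at most 2 M q^m each, in total 4 M q^m. *)
have qm : q ^+ m < r / (4 * M).
  rewrite (le_lt_trans (ler_norm _))//; near: m.
  by have /cvgr0Pnorm_lt := q0; apply; rewrite divr_gt0// mulr_gt0.
have qm1 : q ^+ m.+1 <= q ^+ m.
  have /andP[? /ltW ?] := q01.
  by rewrite exprS ler_piMl// exprn_ge0.
have := dist_Rintegral_setwise_bounded (piE m) M0' (bu bh).1 uhM.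
have := dist_Rintegral_setwise_bounded (piE m.+1) M0' bh.1 hM.
rewrite (tmu m h bh) !ler_norml => /andP[? ?] /andP[? ?].
have : 4 * M * q ^+ m <= r by rewrite mulrC -ler_pdivlMr ?ltW// mulr_gt0.
have : M * q ^+ m.+1 <= M * q ^+ m by rewrite ler_pM2l.
by move=> ? ?; apply/andP; split; lra.
Unshelve. all: by end_near. Qed.

End contracting_operator.

(** * Compact metric spaces *)

Section compact_metric.
Context {d : measure_display} {R : realType} {S : measurableMetricType d R}.
Hypothesis S_compact : compact [set: S].

Lemma compact_finite_net (e : R) : 0 < e ->
  exists l : seq S, forall x, exists2 y, y \in l & mdist y x < e.
Proof.
move=> e0; have cS : cover_compact [set: S] by rewrite -compact_cover.
have [||D' _ cov] := cS S setT (fun x => (ball x e)°).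
- by move=> x _; exact: open_interior.
- by move=> x _; exists x => //; exact: nbhsx_ballx.
exists (finmap.enum_fset D') => x.
have [y yD' /interior_subset] := cov x I.
by rewrite ballEmdist/=; exists y.
Qed.

(** Heine's theorem: finitely many balls of radius [r x] cover the space, while continuity controls
    [f] on the doubled balls. The least of these radii serves as [t]. *)
Lemma compact_uniformly_continuous (f : S -> R) : continuous f ->
  forall e : R, 0 < e -> exists2 t : R, 0 < t &
    forall x y, mdist x y < t -> `|f x - f y| < e.
Proof.
move=> cf e e0.
have e20 : 0 < e / 2 by rewrite divr_gt0.
have rP x : exists r : R, 0 < r /\ forall y, mdist x y < 2 * r -> `|f x - f y| < e / 2.
  have /cvgrPdist_lt/(_ _ e20) := cf x.
  rewrite -nbhs_ballE => -[r/= r0 xr]; exists (r / 2); split; first by rewrite divr_gt0.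
  by move=> y; rewrite mulrC divfK// => xy; apply: xr; rewrite ballEmdist.
have [r rE] := choice rP.
have cS : cover_compact [set: S] by rewrite -compact_cover.
have [||D' _ cov] := cS S setT (fun x => (ball x (r x))°).
- by move=> x _; exact: open_interior.
- by move=> x _; exists x => //; apply: nbhsx_ballx; have [] := rE x.
have [t t0 tr] : exists2 t : R, 0 < t & forall z, z \in finmap.enum_fset D' -> t <= r z.
  elim: (finmap.enum_fset D') => [|z l [t t0 tl]]; first by exists 1.
  have [rz0 _] := rE z; exists (Num.min (r z) t); first by rewrite lt_min rz0.
  by move=> z'; rewrite inE ge_min => /predU1P[->|/tl ->]; rewrite ?lexx ?orbT.
exists t => // x y xy.
have [z zD' /interior_subset] := cov x I.
rewrite ballEmdist/= => zx.
have [rz fz] := rE z.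
have zy : mdist z y < 2 * r z.
  rewrite (le_lt_trans (metric_triangle _ x _))// mulr_natl mulr2n ltrD//.
  exact: lt_le_trans xy (tr z zD').
have fzx : `|f z - f x| < e / 2 by apply: fz; rewrite (lt_trans zx)// ltr_pMl// ltr1n.
have fzy := fz _ zy.
have -> : f x - f y = (f z - f y) - (f z - f x) by ring.
by rewrite (le_lt_trans (ler_normB _ _))// [ltRHS]splitr ltrD.
Qed.

End compact_metric.

Section borel_metric.
Context {d : measure_display} {R : realType} {S : measurableMetricType d R}.
Hypothesis S_borel : borel_space S.

Lemma continuous_mdist (x : S) : continuous (mdist x : S -> R).
Proof.
move=> y; apply/cvgrPdist_lt => e e0; apply/nbhs_ballP; exists e => //= z.
rewrite ballEmdist/= => yz; apply: le_lt_trans yz.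
have := metric_triangle x y z; have := metric_triangle x z y.
rewrite (metric_sym z y) => ? ?.
by rewrite ler_norml; apply/andP; split; lra.
Qed.

Lemma continuous_measurable (f : S -> R) : continuous f -> measurable_fun [set: S] f.
Proof.
move=> /continuousP cf; apply: (measurability _ (RGenOpens.measurableE R)).
move=> _ [_ [a [b ->] <-]]; rewrite setTI S_borel; apply: sub_sigma_algebra.
exact/cf/interval_open.
Qed.

Hypothesis S_compact : compact [set: S].

(** Compactness gives a countable dense set, the union of finite nets, and d(s,t) < r holds iff
    d(q,s) + d(q,t) < r for some q in it. This gives measurability for the product sigma-algebra. *)
Lemma measurable_mdist2 : measurable_fun [set: S * S] (fun z => mdist z.1 z.2 : R).
Proof.
have net (n : nat) : exists l : seq S,
    forall x, exists2 y, y \in l & mdist y x < n.+1%:R^-1 :> R.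
  by apply: compact_finite_net; rewrite ?invr_gt0.
have [l lE] := choice net.
apply: (measurability _ (RGenInftyO.measurableE R)).
move=> _ [_ [r ->] <-]; rewrite setTI.
pose D q := [set z : S * S | mdist q z.1 + mdist q z.2 < r].
have mD q : measurable (D q).
  have mq : measurable_fun [set: S] (mdist q : S -> R).
    by apply: continuous_measurable; exact: continuous_mdist.
  rewrite -[D q]setTI.
  have : measurable_fun [set: S * S] (fun z => mdist q z.1 + mdist q z.2 < r).
    apply: measurable_fun_ltr => //; apply: measurable_funD.
      exact: (measurableT_comp mq measurable_fst).
    exact: (measurableT_comp mq measurable_snd).
  by move=> /(_ measurableT [set true] I).
rewrite (_ : _ @^-1` _ = \bigcup_n \big[setU/set0]_(q <- l n) D q); last first.
  apply/seteqP; split => -[s t] /=; rewrite in_itv/=.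
    (* A net point closer to s than half of r - d(s,t) works, since d(q,t) <= d(q,s) + d(s,t). *)
    move=> str; have rst : 0 < (r - mdist s t) / 2 by rewrite divr_gt0// subr_gt0.
    have /filter_ex[n /= /ltW nr] := near_infty_natSinv_lt (PosNum rst).
    have [q ql qs] := lE n s; exists n => //.
    rewrite -bigcup_seq; exists q => //=.
    rewrite /D/=; have := lt_le_trans qs nr.
    rewrite ltr_pdivlMr// ltrBrDr mulr_natr mulr2n -addrA; apply: le_lt_trans.
    by rewrite lerD2l metric_triangle.
  move=> [n _]; rewrite -bigcup_seq => -[q _]; rewrite /D/=; apply: le_lt_trans.
  by rewrite (metric_sym q s) metric_triangle.
by apply: bigcupT_measurable => n; exact: bigsetU_measurable.
Qed.

End borel_metric.

(** * Independent samples and one step of the chain *)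

Section iid.
Context {d : measure_display} {T : measurableType d} {R : realType}.
Implicit Types theta : probability T R.

Lemma Rintegral_iidS theta n (f : n.+1.-tuple T -> R) : bounded_measurable f ->
  \int[iid theta n.+1]_y f y =
  \int[theta]_x \int[iid theta n]_y f (cons_pair (x, y)).
Proof.
move=> bf.
have bfc : bounded_measurable (fun p => f (cons_pair (n := n) p)).
  exact: (bounded_measurable_comp bf (@measurable_cons_pair _ _ n)).
rewrite -(Rintegral_prod theta (iid theta n) bfc) /Rintegral; congr fine.
apply: (@integral_distribution _ _ _ _ _ (theta \x iid theta n)%E (@cons_pair _ _ n)
  (EFin \o f)); first by apply/measurable_EFinP; exact: bf.1.
exact: (bounded_measurable_integrable _ bfc).
Qed.

(** For an indicator [h] this is the probability that all the samples fall into one set. *)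
Lemma Rintegral_iid_prod theta n (h : T -> R) : bounded_measurable h ->
  bounded_measurable (fun y : n.-tuple T => \prod_(i < n) h (tnth y i)) /\
  \int[iid theta n]_y \prod_(i < n) h (tnth y i) = (\int[theta]_x h x) ^+ n.
Proof.
move=> bh.
have bp m : bounded_measurable (fun y : m.-tuple T => \prod_(i < m) h (tnth y i)).
  elim: (index_enum _) => [|i r IH].
    under eq_fun do rewrite big_nil; exact: bounded_measurable_cst.
  under eq_fun do rewrite big_cons; apply: bounded_measurableM => //.
  exact: (bounded_measurable_comp bh (measurable_tnth i)).
split => //; elim: n => [|n IH].
  rewrite expr0 -[RHS](Rintegral_cst1 (iid theta 0)).
  by apply: eq_Rintegral => y _; rewrite big_ord0.
rewrite Rintegral_iidS// exprS.
transitivity (\int[theta]_x (h x * (\int[theta]_x h x) ^+ n)); last first.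
  by rewrite RintegralZr//; exact: bounded_measurable_integrable.
apply: eq_Rintegral => x _; rewrite -IH -RintegralZl//; last first.
  exact: (bounded_measurable_integrable _ (bp n)).
apply: eq_Rintegral => y _; rewrite big_ord_recl; congr (_ * _).
by apply: eq_bigr => i _; rewrite tnthS.
Qed.

End iid.

Section step_mean.
Context {d : measure_display} {R : realType} {S : measurableMetricType d R}.
Variables (j k : nat).
Hypothesis jk : (j.-1 < k)%N.
Implicit Types (s : S) (y : k.-tuple S) (h : S -> R).

(* The mean of h at the next position of the chain, given the samples y; on
   indicators this is [step_given]. *)
Definition step_mean h s y : R :=
  (\sum_(tau : 'S_k | increasing_arrangement s y tau)
      h (nth s (arrangement y tau) j.-1))
  / #|[pred tau : 'S_k | increasing_arrangement s y tau]|%:R.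

(** With the position in range, the default [s] of [nth] is never returned, and the result is one of
    the samples. *)
Lemma nth_arrangement s y tau (i : nat) (ik : (i < k)%N) :
  nth s (arrangement y tau) i = tnth y (tau (Ordinal ik)).
Proof. by rewrite -[i]/(val (Ordinal ik)) -tnth_nth tnth_mktuple. Qed.

(** Sortedness becomes a finite conjunction of comparisons of distances. Both the measurability in
    (s, y) and the stability under perturbation rest on this form. *)
Lemma increasing_arrangementE s y tau : increasing_arrangement s y tau =
  [forall a : 'I_k, forall b : 'I_k, (a < b)%N ==>
    (mdist s (tnth y (tau a)) <= mdist s (tnth y (tau b)))].
Proof.
rewrite /increasing_arrangement sorted_pairwise; last first.
  by move=> u v w /= vu uw; exact: le_trans vu uw.
apply/(pairwiseP s)/idP => [H|/'forall_'forall_implyP H].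
  apply/'forall_'forall_implyP => -[a ak] [b bk] ab.
  have := H a b; rewrite !inE size_tuple => /(_ ak bk ab).
  by rewrite !nth_arrangement.
move=> a b; rewrite !inE size_tuple => ak bk ab.
by rewrite !nth_arrangement; exact: H.
Qed.

(** Sorting the samples produces one such permutation, so the average in [step_mean] never divides
    by 0. *)
Lemma increasing_arrangement_card_gt0 s y :
  (0 < #|[pred tau : 'S_k | increasing_arrangement s y tau]|)%N.
Proof.
pose r : rel S := fun u v => mdist s u <= mdist s v.
have /tuple_permP[tau tauE] : perm_eq (sort r y) y by rewrite perm_sort.
apply/card_gt0P; exists tau; rewrite inE /increasing_arrangement/= -tauE.
by apply: sort_sorted => u v; exact: le_total.
Qed.

Lemma step_mean_cst (c : R) s y : step_mean (fun _ => c) s y = c.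
Proof.
have E : \sum_(tau : 'S_k | increasing_arrangement s y tau) c =
    c * #|[pred tau : 'S_k | increasing_arrangement s y tau]|%:R.
  by rewrite sumr_const mulr_natr.
rewrite /step_mean E mulfK// pnatr_eq0 -lt0n.
exact: increasing_arrangement_card_gt0.
Qed.

Lemma step_mean_le h1 h2 s y : (forall i, h1 (tnth y i) <= h2 (tnth y i)) ->
  step_mean h1 s y <= step_mean h2 s y.
Proof.
move=> hh; rewrite /step_mean ler_wpM2r ?invr_ge0//.
by apply: ler_sum => tau _; rewrite (nth_arrangement _ _ _ jk).
Qed.

Lemma step_mean_between h (a b : R) s y : (forall i, a <= h (tnth y i) <= b) ->
  a <= step_mean h s y <= b.
Proof.
move=> hab; rewrite -[in X in X && _](step_mean_cst a s y).
rewrite -[in X in _ && X](step_mean_cst b s y).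
by apply/andP; split; apply: step_mean_le => i; case/andP: (hab i).
Qed.

(** If all comparisons of distances agree, the admissible permutations are the same, and the two
    averages are compared term by term. *)
Lemma step_mean_near h (e : R) s y s' y' :
  (forall a b, (mdist s (tnth y a) <= mdist s (tnth y b)) =
               (mdist s' (tnth y' a) <= mdist s' (tnth y' b))) ->
  (forall i, `|h (tnth y i) - h (tnth y' i)| <= e) ->
  `|step_mean h s y - step_mean h s' y'| <= e.
Proof.
move=> same he.
have incE : increasing_arrangement s y =1 increasing_arrangement s' y'.
  move=> tau; rewrite !increasing_arrangementE.
  by apply: eq_forallb => a; apply: eq_forallb => b; rewrite same.
rewrite /step_mean (eq_bigl _ _ incE).
have -> : #|[pred tau : 'S_k | increasing_arrangement s y tau]| =
    #|[pred tau : 'S_k | increasing_arrangement s' y' tau]|.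
  by apply: eq_card => tau; rewrite !inE incE.
rewrite -mulrBl normrM normfV (ger0_norm (ler0n _ _)) ler_pdivrMr ?ltr0n; last first.
  exact: increasing_arrangement_card_gt0.
rewrite -sumrB mulr_natr -[leRHS]sumr_const (le_trans (ler_norm_sum _ _ _))//.
by apply: ler_sum => tau _; rewrite !(nth_arrangement _ _ _ jk).
Qed.

Hypothesis S_borel : borel_space S.
Hypothesis S_compact : compact [set: S].

Lemma measurable_sample_dist (i : 'I_k) :
  measurable_fun [set: S * k.-tuple S] (fun z => mdist z.1 (tnth z.2 i) : R).
Proof.
apply: (measurableT_comp (measurable_mdist2 S_borel S_compact)
  (g := fun z : S * k.-tuple S => (z.1, tnth z.2 i))).
apply: measurable_fun_pair => //.
exact: (measurableT_comp (measurable_tnth i) measurable_snd).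
Qed.

Lemma measurable_increasing_arrangement tau : measurable_fun
  [set: S * k.-tuple S] (fun z => increasing_arrangement z.1 z.2 tau).
Proof.
under eq_fun do rewrite increasing_arrangementE.
apply: measurable_forall => a; apply: measurable_forall => b.
case: (a < b)%N => /=; last exact: measurable_cst.
by apply: measurable_fun_ler; exact: measurable_sample_dist.
Qed.

Lemma bounded_measurable_step_mean h : bounded_measurable h ->
  bounded_measurable (fun z : S * k.-tuple S => step_mean h z.1 z.2).
Proof.
move=> [mh [M hM]]; split; last first.
  exists M => z; rewrite ler_norml; apply: step_mean_between => i.
  by rewrite -ler_norml.
have m1 tau : measurable_fun [set: S * k.-tuple S]
    (fun z => (increasing_arrangement z.1 z.2 tau)%:R : R).
  have : measurable_fun [set: S * k.-tuple S]
      (fun z => if increasing_arrangement z.1 z.2 tau then 1 else 0 : R).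
    by apply: measurable_fun_ifT => //; exact: measurable_increasing_arrangement.
  by apply: eq_measurable_fun => z _; case: increasing_arrangement.
(* The range of summation depends on z; 0-1 weights turn numerator and denominator into sums over
   all permutations. *)
rewrite (_ : (fun z => _) = fun z : S * k.-tuple S =>
    (\sum_(tau : 'S_k) (increasing_arrangement z.1 z.2 tau)%:R *
       h (tnth z.2 (tau (Ordinal jk)))) *
    (\sum_(tau : 'S_k) (increasing_arrangement z.1 z.2 tau)%:R)^-1); last first.
  apply/funext => z; rewrite /step_mean; congr (_ * _^-1).
    rewrite big_mkcond/=; apply: eq_bigr => tau _; rewrite (nth_arrangement _ _ _ jk).
    by case: increasing_arrangement; rewrite ?mul1r ?mul0r.
  rewrite -sum1_card natr_sum big_mkcond/=; apply: eq_bigr => tau _.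
  by rewrite inE; case: increasing_arrangement.
apply: measurable_funM.
  apply: measurable_sum => tau; apply: measurable_funM => //.
  apply: (measurableT_comp mh).
  exact: (measurableT_comp (measurable_tnth _) measurable_snd).
(* The inverse of a nonnegative number is its power -1, a measurable function. *)
under eq_fun do rewrite -powR_inv1 ?sumr_ge0//.
exact: (measurableT_comp (measurable_powR (-1)) (measurable_sum _ m1)).
Qed.

End step_mean.

(** * The transition operator and its contraction *)

Section chain.
Context {d : measure_display} {R : realType} {S : measurableMetricType d R}.
Variables (j k : nat).
Hypothesis jk : (j.-1 < k)%N.
Hypothesis S_borel : borel_space S.
Hypothesis S_compact : compact [set: S].
Implicit Types (theta mu nu : probability S R) (h : S -> R).

(** The transition operator of the chain acting on functions; on indicators of measurable sets it
    agrees with [step]. *)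
Definition chain_mean theta h s : R := \int[iid theta k]_y step_mean j h s y.

Let bsm h (bh : bounded_measurable h) :=
  bounded_measurable_step_mean jk S_borel S_compact bh.

Lemma bounded_measurable_chain_mean theta h : bounded_measurable h ->
  bounded_measurable (chain_mean theta h).
Proof. by move=> bh; exact: (bounded_measurable_Rintegral (iid theta k) (bsm bh)). Qed.

Lemma bounded_measurable_step_mean_sample h s : bounded_measurable h ->
  bounded_measurable (fun y : k.-tuple S => step_mean j h s y).
Proof. by move=> bh; exact: (bounded_measurable_xsection (bsm bh) s). Qed.

(** The product is the indicator of the event that all samples lie in A; on that event the next
    state lies in A too, whichever sample is chosen. *)
Lemma step_mean_ge_all (A : set S) h (a c : R) s (y : k.-tuple S) :
  a <= c -> (forall x, a <= h x) -> (forall x, A x -> c <= h x) ->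
  a + (c - a) * \prod_(i < k) \1_A (tnth y i) <= step_mean j h s y.
Proof.
move=> ac ah Ach; have [/forallP yA|/forallPn[i yA]] := boolP [forall i, tnth y i \in A].
  rewrite big1; last by move=> i _; rewrite indicE yA.
  rewrite mulr1 addrC subrK.
  rewrite -[leLHS](step_mean_cst j c s y); apply: step_mean_le => // i.
  by apply: Ach; have := yA i; rewrite inE.
rewrite (bigD1 i)//= indicE (negbTE yA) mul0r mulr0 addr0.
rewrite -[leLHS](step_mean_cst j a s y); exact: step_mean_le.
Qed.

Lemma chain_mean_ge theta (A : set S) h (a c : R) s : measurable A ->
  bounded_measurable h -> a <= c -> (forall x, a <= h x) -> (forall x, A x -> c <= h x) ->
  a + (c - a) * fine (theta A) ^+ k <= chain_mean theta h s.
Proof.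
move=> mA bh ac ah Ach.
have [bp pE] := Rintegral_iid_prod theta k (bounded_measurable_indic (R := R) mA).
have bcp : bounded_measurable
    (fun y : k.-tuple S => (c - a) * \prod_(i < k) \1_A (tnth y i)).
  by apply: bounded_measurableM => //; exact: bounded_measurable_cst.
have ba : bounded_measurable (fun y : k.-tuple S => a) by exact: bounded_measurable_cst.
rewrite -Rintegral_indic// -pE -RintegralZl//; last first.
  exact: (bounded_measurable_integrable _ bp).
rewrite -[X in X + _](Rintegral_cst1 (iid theta k) a) -RintegralD_bounded//.
apply: le_Rintegral_bounded.
- exact: bounded_measurableD.
- exact: bounded_measurable_step_mean_sample.
- by move=> y; exact: step_mean_ge_all.
Qed.

Lemma chain_mean_opp theta h s : bounded_measurable h ->
  chain_mean theta (fun x => - h x) s = - chain_mean theta h s.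
Proof.
move=> bh; rewrite -mulN1r -RintegralZl//; last first.
  exact: (bounded_measurable_integrable _ (bounded_measurable_step_mean_sample s bh)).
by apply: eq_Rintegral => y _; rewrite mulN1r /step_mean sumrN mulNr.
Qed.

(* Either {h >= (a + b)/2} or its complement has theta-mass at least 1/2, and then
   all k samples fall there with probability at least 2^-k: this raises the lower
   bound or lowers the upper bound, whatever the state s. *)
Lemma chain_mean_osc theta h (a b : R) : bounded_measurable h ->
  (forall x, a <= h x <= b) ->
  exists a' b', [/\ a <= a', b' <= b, b' - a' = (1 - 2^-1 ^+ k.+1) * (b - a) &
                    forall s, a' <= chain_mean theta h s <= b'].
Proof.
move=> bh hab.
have ab : a <= b by have /andP[] := hab point; exact: le_trans.
have hmab s : a <= chain_mean theta h s <= b.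
  apply: Rintegral_between; first exact: bounded_measurable_step_mean_sample.
  by move=> y; exact: step_mean_between.
pose c := (a + b) / 2; pose A := [set x | c <= h x].
have mA : measurable A.
  rewrite -[A]setTI; have : measurable_fun [set: S] (fun x => c <= h x).
    by apply: measurable_fun_ler => //; exact: bh.1.
  by move=> /(_ measurableT [set true] I).
have q0 : (0 : R) <= 2^-1 ^+ k.+1 by rewrite exprn_ge0.
have le_pow (p : R) : 2^-1 <= p -> 2^-1 ^+ k <= p ^+ k.
  by move=> ?; rewrite lerXn2r ?nnegrE// (le_trans _ (_ : 2^-1 <= p)).
have bq : 0 <= (b - a) * 2^-1 ^+ k.+1 by rewrite mulr_ge0// subr_ge0.
have ca : c - a = (b - a) * 2^-1 by rewrite /c; lra.
have bc : b - c = (b - a) * 2^-1 by rewrite /c; lra.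
(* One factor 1/2 comes from the distance of [c] to the ends of the range, the other k from the
   samples. *)
have gain (p : R) : 2^-1 <= p -> (b - a) * 2^-1 ^+ k.+1 <= (b - a) * 2^-1 * p ^+ k.
  by move=> ?; rewrite exprS mulrA ler_wpM2l ?le_pow// mulr_ge0// subr_ge0.
have [pA|pA] := leP 2^-1 (fine (theta A)).
  exists (a + (b - a) * 2^-1 ^+ k.+1), b; split => //; first by rewrite lerDl.
    by ring.
  move=> s; have /andP[_ ->] := hmab s; rewrite andbT.
  have acA : a <= c by rewrite -subr_ge0 ca mulr_ge0// subr_ge0.
  apply: le_trans (@chain_mean_ge theta A h a c s mA bh acA _ _).
  - by rewrite lerD2l ca gain.
  - by move=> x; case/andP: (hab x).
  - by [].
exists a, (b - (b - a) * 2^-1 ^+ k.+1); split => //; first by rewrite gerBl.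
  by ring.
(* The upper bound for [h] is the lower bound for its negative, with the complement of [A] as the
   likely set. *)
move=> s; have /andP[-> _] := hmab s; rewrite /= -lerN2 -chain_mean_opp//.
have bcA : - b <= - c by rewrite lerN2 -subr_ge0 bc mulr_ge0// subr_ge0.
have bNh : bounded_measurable (fun x => - h x).
  under eq_fun do rewrite -sub0r.
  by apply: bounded_measurableB => //; exact: bounded_measurable_cst.
apply: le_trans
  (@chain_mean_ge theta (~` A) _ (- b) (- c) s (measurableC mA) bNh bcA _ _).
- rewrite opprB addrC lerD2l opprK [- c + b]addrC bc gain//.
  rewrite probability_setC// fineB// ?fin_num_measure//=; move: pA; lra.
- by move=> x; rewrite lerN2; case/andP: (hab x).
- by move=> x; rewrite /A/= lerN2 => /negP; rewrite -ltNge => /ltW.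
Qed.

(** The law after one step is a mixture: draw the state and the samples from the product measure,
    then pick uniformly from the list [c] of candidates, one for each increasing arrangement. *)
Lemma chain_transportsE theta mu : exists nu, transports (chain_mean theta) mu nu.
Proof.
pose M := (mu \x iid theta k)%E : probability _ R.
have LE (z : S * k.-tuple S) : exists Q : probability S R,
    forall h, bounded_measurable h -> \int[Q]_x h x = step_mean j h z.1 z.2.
  pose c := [seq nth z.1 (arrangement z.2 tau) j.-1 |
    tau <- enum [pred tau : 'S_k | increasing_arrangement z.1 z.2 tau]].
  have sc : size c = #|[pred tau : 'S_k | increasing_arrangement z.1 z.2 tau]|.
    by rewrite size_map cardE.
  have c0 : c != [::].
    by rewrite -size_eq0 sc -lt0n increasing_arrangement_card_gt0.
  have [Q QE] := empirical_measure (R := R) c0.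
  exists Q => h bh; rewrite QE// sc /step_mean big_map; congr (_ / _).
  by rewrite big_enum_cond; apply: eq_bigl => tau; rewrite !inE andbT.
have [L LE'] := choice LE.
have mL A : measurable A -> measurable_fun [set: S * k.-tuple S] (fun z => fine (L z A)).
  move=> mA; have bA := bounded_measurable_indic (R := R) mA.
  under eq_fun do rewrite -Rintegral_indic// LE'//.
  exact: (bsm bA).1.
have [Q QE] := kernel_bind M mL.
exists Q => h bh; rewrite QE//.
under eq_Rintegral do rewrite LE'//.
exact: (Rintegral_prod mu (iid theta k) (bsm bh)).
Qed.

Lemma step_chain_mean theta s A : measurable A ->
  step j k theta s A = (chain_mean theta (\1_A) s)%:E.
Proof.
move=> mA; rewrite EFin_Rintegral//.
exact: (bounded_measurable_step_mean_sample s (bounded_measurable_indic mA)).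
Qed.

(** Stationarity tests indicators only. It extends to bounded functions because the one-step law
    [nu] of [mu] is a measure, which then agrees with [mu] on all measurable sets. *)
Lemma stationaryP theta mu :
  stationary j k theta mu <-> transports (chain_mean theta) mu mu.
Proof.
split=> [st h bh|tr A mA].
  have [nu nuE] := chain_transportsE theta mu.
  have nuA A : measurable A -> nu A = mu A.
    move=> mA; have bA := bounded_measurable_indic (R := R) mA.
    rewrite -[LHS]fineK ?fin_num_measure// -Rintegral_indic// nuE//.
    rewrite EFin_Rintegral; last exact: bounded_measurable_chain_mean.
    by rewrite -(st _ mA); apply: eq_integral => s _; rewrite step_chain_mean.
  by rewrite -nuE//; congr fine; apply: eq_measure_integral => A mA _; rewrite /= nuA.
under eq_integral do rewrite step_chain_mean//.
have bA := bounded_measurable_indic (R := R) mA.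
rewrite -EFin_Rintegral; last exact: bounded_measurable_chain_mean.
by rewrite -tr// Rintegral_indic// fineK// fin_num_measure.
Qed.

Lemma pow_half_bounds : 0 <= 1 - (2^-1 : R) ^+ k.+1 < 1.
Proof.
by rewrite subr_ge0 exprn_ile1 ?invf_le1 ?ler1n//= gtrBl exprn_gt0.
Qed.

(** The fixed point of the contraction witnesses existence, so [get] returns a stationary law and
    not its default. *)
Lemma pi_jk_transports theta :
  transports (chain_mean theta) (pi_jk j k theta) (pi_jk j k theta).
Proof.
have [pi piE] := transports_fixpoint pow_half_bounds
  (@bounded_measurable_chain_mean theta) (@chain_mean_osc theta)
  (chain_transportsE theta).
apply/stationaryP; rewrite /pi_jk; case: xgetP => [x -> //|no].
by have /stationaryP := piE; move/no.
Qed.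

End chain.

(** * Weak convergence of product measures *)

Section weak_convergence.
Context {d : measure_display} {R : realType} {S : measurableMetricType d R}.
Hypothesis S_borel : borel_space S.
Hypothesis S_compact : compact [set: S].

Lemma continuous_bounded_measurable (f : S -> R) : continuous f -> bounded_measurable f.
Proof.
move=> cf; split; first exact: continuous_measurable.
have [l lE] := compact_finite_net S_compact (ltr01 : 0 < 1 :> R).
have := continuous_compact (continuous_subspaceT cf) S_compact.
move=> /compact_bounded[M [_ /(_ (M + 1))]].
rewrite ltrDl ltr01 => /(_ isT) fM.
by exists (M + 1) => x; apply: fM; exists x.
Qed.

Lemma weakly_convergesP (mu_ : nat -> probability S R) (mu : probability S R) :
  weakly_converges mu_ mu <-> forall f : S -> R, continuous f ->
    (\int[mu_ n]_x f x) @[n --> \oo] --> \int[mu]_x f x.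
Proof.
have E (f : S -> R) (cf : continuous f) (P : probability S R) :
    (\int[P]_x (f x)%:E)%E = (\int[P]_x f x)%:E.
  by rewrite EFin_Rintegral//; exact: continuous_bounded_measurable.
split=> [w f cf|w f cf _].
  have [_ [M fM]] := continuous_bounded_measurable cf.
  have : bounded_fun f.
    exists M; split; first exact: num_real.
    by move=> N MN x _; exact: le_trans (fM x) (ltW MN).
  by move=> /(w f cf); rewrite E// => /fine_cvg.
rewrite E//; under eq_fun do rewrite E//.
by apply: cvg_EFin; [near=> n|exact: w].
Unshelve. all: by end_near. Qed.

(** Through a finite net, equicontinuity upgrades pointwise convergence to uniform convergence; weak
    convergence is then applied to the single continuous limit [h]. *)
Lemma equicontinuous_cvg (mu_ : nat -> probability S R) (mu : probability S R)
    (h_ : nat -> S -> R) (h : S -> R) :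
  weakly_converges mu_ mu -> (forall n, bounded_measurable (h_ n)) ->
  (forall e : R, 0 < e -> exists2 t : R, 0 < t &
    forall n x y, mdist x y < t -> `|h_ n x - h_ n y| <= e) ->
  (forall x, h_ n x @[n --> \oo] --> h x) ->
  (\int[mu_ n]_x h_ n x) @[n --> \oo] --> \int[mu]_x h x.
Proof.
move=> /weakly_convergesP w bh_ equi ptw.
have hequi e t : (forall n x y, mdist x y < t -> `|h_ n x - h_ n y| <= e) ->
    forall x y, mdist x y < t -> `|h x - h y| <= e.
  move=> te x y xy; have c : `|h_ n x - h_ n y| @[n --> \oo] --> `|h x - h y|.
    by apply: cvg_norm; exact: cvgB.
  rewrite -(cvg_lim _ c)//; apply: limr_le; first exact: cvgP c.
  by near=> n; exact: te.
have ch : continuous h.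
  move=> x; apply/cvgrPdist_le => e e0; have [t t0 te] := equi e e0.
  by apply/nbhs_ballP; exists t => //= y; rewrite ballEmdist/=; exact: (hequi e t te).
have bh := continuous_bounded_measurable ch.
apply/cvgrPdist_le => e e0.
have e40 : 0 < e / 4 by rewrite divr_gt0.
have [t t0 te] := equi _ e40.
have [l lE] := compact_finite_net S_compact t0.
(* Three quarters of [e]: from x to a net point for [h_ n], from [h_ n] to [h] there, and back for
   [h]. Weak convergence takes the fourth. *)
have near_h : \forall n \near \oo, forall x, `|h_ n x - h x| <= e / 4 + e / 4 + e / 4.
  have : \forall n \near \oo, forall q, q \in l -> `|h_ n q - h q| <= e / 4.
    elim: l {lE} => [|q l IH]; first by near=> n.
    near=> n => p; rewrite inE => /predU1P[->|].
      by rewrite distrC; near: n; move/cvgrPdist_le : (ptw q); exact.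
    by move: p; near: n.
  apply: filterS => n nl x; have [q ql qx] := lE x.
  have := nl q ql; have := te n _ _ qx; have := hequi _ _ te _ _ qx.
  rewrite !ler_norml => /andP[? ?] /andP[? ?] /andP[? ?].
  by apply/andP; split; lra.
have : \forall n \near \oo, `|\int[mu]_x h x - \int[mu_ n]_x h x| <= e / 4.
  by move/cvgrPdist_le : (w h ch); exact.
apply: filter_app; move: near_h; apply: filterS => n hn.
have := dist_Rintegral_le (mu_ n) (bh_ n) bh hn.
rewrite !ler_norml => /andP[? ?] /andP[? ?].
by apply/andP; split; lra.
Unshelve. all: by end_near. Qed.

(** Closeness in the maximum metric, used directly in moduli of continuity so that no topology on
    tuples enters. *)
Definition tuple_close n (t : R) (y y' : n.-tuple S) : Prop :=
  forall i, mdist (tnth y i) (tnth y' i) < t.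

Section parametric.
Variables (theta_ : nat -> probability S R) (theta : probability S R).
Hypothesis theta_cvg : weakly_converges theta_ theta.

Let iid_cvg n := forall F : n.-tuple S -> R, bounded_measurable F ->
  (forall e : R, 0 < e -> exists2 t : R, 0 < t &
    forall y y', tuple_close t y y' -> `|F y - F y'| <= e) ->
  (\int[iid (theta_ m) n]_y F y) @[m --> \oo] --> \int[iid theta n]_y F y.

(** After the samples are integrated out, the functions of s inherit the modulus of continuity of
    [F], uniformly in [m], and converge pointwise by [iid_cvg n]. *)
Let product_cvg_of n : iid_cvg n ->
  forall (mu_ : nat -> probability S R) (mu : probability S R),
  weakly_converges mu_ mu ->
  forall F : S -> n.-tuple S -> R,
  bounded_measurable (fun z : S * n.-tuple S => F z.1 z.2) ->
  (forall e : R, 0 < e -> exists2 t : R, 0 < t &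
    forall s s' y y', mdist s s' < t -> tuple_close t y y' ->
      `|F s y - F s' y'| <= e) ->
  (\int[mu_ m]_s \int[iid (theta_ m) n]_y F s y) @[m --> \oo] -->
  \int[mu]_s \int[iid theta n]_y F s y.
Proof.
move=> IH mu_ mu w F bF uF.
have bFs s : bounded_measurable (F s) := bounded_measurable_xsection bF s.
apply: (@equicontinuous_cvg mu_ mu (fun m s => \int[iid (theta_ m) n]_y F s y)) => //.
- by move=> m; exact: (bounded_measurable_Rintegral _ bF).
- move=> e e0; have [t t0 te] := uF e e0; exists t => // m s s' ss'.
  apply: dist_Rintegral_le => // y; apply: te => // i.
  by rewrite mdistxx.
- move=> s; apply: IH => // e e0; have [t t0 te] := uF e e0; exists t => // y y' yy'.
  by apply: te => //; rewrite mdistxx.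
Qed.

(** Induction on the number of samples: the first sample plays the role of the state, with the laws
    [theta_] themselves. *)
Lemma Rintegral_iid_cvg n : iid_cvg n.
Proof.
elim: n => [|n IH] F bF uF.
  have E (P : probability (0.-tuple S) R) : \int[P]_y F y = F [tuple].
    by rewrite -[RHS](Rintegral_cst1 P); apply: eq_Rintegral => y _; rewrite tuple0.
  by under eq_fun do rewrite E; rewrite E; exact: cvg_cst.
under eq_fun do rewrite Rintegral_iidS//; rewrite Rintegral_iidS//.
apply: (@product_cvg_of n IH _ _ theta_cvg (fun s y => F (cons_pair (s, y)))).
  apply: (bounded_measurable_comp
    (u := fun z : S * n.-tuple S => cons_pair (z.1, z.2)) bF).
  apply: (measurableT_comp (@measurable_cons_pair _ _ n)).
  exact: measurable_fun_pair.
move=> e e0; have [t t0 te] := uF e e0; exists t => // s s' y y' ss' yy'.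
apply: te => i; case: (unliftP ord0 i) => [i' ->|->]; rewrite ?tnthS ?tnth0//.
Qed.

Lemma Rintegral_product_cvg n (mu_ : nat -> probability S R) (mu : probability S R) :
  weakly_converges mu_ mu ->
  forall F : S -> n.-tuple S -> R,
  bounded_measurable (fun z : S * n.-tuple S => F z.1 z.2) ->
  (forall e : R, 0 < e -> exists2 t : R, 0 < t &
    forall s s' y y', mdist s s' < t -> tuple_close t y y' ->
      `|F s y - F s' y'| <= e) ->
  (\int[mu_ m]_s \int[iid (theta_ m) n]_y F s y) @[m --> \oo] -->
  \int[mu]_s \int[iid theta n]_y F s y.
Proof. exact: (product_cvg_of (n := n) (Rintegral_iid_cvg (n := n))). Qed.

End parametric.
End weak_convergence.

(** * Ties *)

Lemma bounded_cvg0_Rintegral {d : measure_display} {T : measurableType d}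
    {R : realType} (P : probability T R) (f_ : nat -> T -> R) (C : R) (N : set T) :
  (forall n, bounded_measurable (f_ n)) -> (forall n x, `|f_ n x| <= C) ->
  measurable N -> P N = 0%E -> (forall x, ~ N x -> f_ n x @[n --> \oo] --> (0 : R)) ->
  (\int[P]_x f_ n x) @[n --> \oo] --> (0 : R).
Proof.
move=> bf fC mN PN f0.
have mf n : measurable_fun [set: T] (EFin \o f_ n).
  by apply/measurable_EFinP; exact: (bf n).1.
have f0' : {ae P, forall x, [set: T] x ->
    (EFin \o f_ n) x @[n --> \oo] --> (cst 0%E : T -> \bar R) x}.
  exists N; split => // x /= xN; apply: contrapT => Nx; apply: xN => _.
  by apply: cvg_EFin; [near=> n|exact: f0].
have fC' : {ae P, forall x n, [set: T] x -> (`|(EFin \o f_ n) x| <= (cst C%:E) x)%E}.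
  by apply: aeW => x n _; rewrite lee_fin.
have iC : P.-integrable [set: T] (cst C%:E) by exact: finite_measure_integrable_cst.
have [_ _] := dominated_convergence measurableT mf (measurable_cst _) f0' iC fC'.
rewrite integral0 => /fine_cvg; exact.
Unshelve. all: by end_near. Qed.

Section ties.
Context {d : measure_display} {R : realType} {S : measurableMetricType d R}.
Hypothesis S_borel : borel_space S.
Hypothesis S_compact : compact [set: S].

Definition no_tie n (s : S) (y : n.-tuple S) : bool :=
  uniq (map (mdist s : S -> R) y).

Lemma no_tieE n s (y : n.-tuple S) : no_tie s y =
  [forall a : 'I_n, forall b : 'I_n, (a != b) ==>
    (mdist s (tnth y a) != mdist s (tnth y b) :> R)].
Proof.
rewrite /no_tie; apply/(tuple_uniqP [tuple of map (mdist s) y])/'forall_'forall_implyP.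
  move=> inj a b; apply: contraNN => /eqP ab; apply/eqP/inj.
  by rewrite !tnth_map.
move=> H a b; rewrite !tnth_map => ab; apply/eqP/negPn/negP => /H.
by rewrite ab eqxx.
Qed.

Lemma measurable_sample_dist1 n s (i : 'I_n) :
  measurable_fun [set: n.-tuple S] (fun y => mdist s (tnth y i) : R).
Proof.
have ms : measurable_fun [set: S] (mdist s : S -> R).
  by apply: continuous_measurable => //; exact: continuous_mdist.
exact: (measurableT_comp ms (measurable_tnth i)).
Qed.

Lemma measurable_no_tie n s : measurable_fun [set: n.-tuple S] (no_tie s).
Proof.
rewrite (funext (no_tieE s)).
apply: measurable_forall => a; apply: measurable_forall => b.
case: (a != b) => /=; last exact: measurable_cst.
under eq_fun do rewrite neq_lt.
by apply: measurable_or; apply: measurable_fun_ltr; exact: measurable_sample_dist1.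
Qed.

Lemma measurable_tie n s : measurable [set y : n.-tuple S | ~~ no_tie s y].
Proof.
have := measurable_no_tie (n := n) s => /(_ measurableT [set false] I).
by rewrite setTI; congr measurable; apply/seteqP; split => y /=; case: no_tie.
Qed.

Lemma nonatomic_notin (theta : probability S R) s (l : seq R) :
  nonatomic (pushforward theta (mdist s)) ->
  measurable [set x | mdist s x \in l] /\ theta [set x | mdist s x \in l] = 0%E.
Proof.
move=> na; elim: l => [|r l [ml tl]].
  rewrite (_ : [set _ | _] = set0) ?measure0//.
  by apply/seteqP; split.
have mr : measurable [set x | mdist s x = r].
  have ms : measurable_fun [set: S] (mdist s : S -> R).
    by apply: continuous_measurable => //; exact: continuous_mdist.
  by rewrite -[X in measurable X]setTI; exact: (ms measurableT [set r]).
rewrite (_ : [set _ | _] = [set x | mdist s x \in l] `|` [set x | mdist s x = r]).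
  split; first exact: measurableU.
  by rewrite measureU0//; exact: na r.
by apply/seteqP; split => x /=; rewrite inE;
  [case/predU1P => ?; [right|left]|case=> [->|->]; rewrite ?orbT ?eqxx].
Qed.

(** Induction on n: once the other samples are fixed by Fubini, a new sample creates a tie only if
    its distance to s lies in a finite list, a null event. *)
Lemma nonatomic_no_tie (theta : probability S R) s n :
  nonatomic (pushforward theta (mdist s)) ->
  \int[iid theta n]_y (no_tie s y)%:R = 1 :> R.
Proof.
move=> na; elim: n => [|n IH].
  rewrite -[RHS](Rintegral_cst1 (iid theta 0)).
  by apply: eq_Rintegral => y _; rewrite tuple0.
have bt m : bounded_measurable (fun y : m.-tuple S => (no_tie s y)%:R : R).
  apply: (@bounded_measurable_between _ _ _ 0 1) => [|y]; last first.
    by case: no_tie; rewrite /= ?lexx ?ler01.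
  have : measurable_fun [set: m.-tuple S] (fun y => if no_tie s y then 1 else 0 : R).
    by apply: measurable_fun_ifT => //; exact: measurable_no_tie.
  by apply: eq_measurable_fun => z _; case: no_tie.
have bc : bounded_measurable (fun z : S * n.-tuple S => (no_tie s (cons_pair z))%:R : R).
  exact: (bounded_measurable_comp (bt _) (@measurable_cons_pair _ _ n)).
rewrite Rintegral_iidS// (Rintegral_Fubini _ _ bc) -[RHS]IH; apply: eq_Rintegral => y _.
have [ml tl] := nonatomic_notin (map (mdist s) y) na.
transitivity (\int[theta]_x
    (\1_(~` [set x | mdist s x \in map (mdist s) y]) x * (no_tie s y)%:R)).
  apply: eq_Rintegral => x _; rewrite /no_tie/= indicE.
  rewrite (_ : (x \in _) = (mdist s x \notin map (mdist s) y)); last first.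
    by apply/idP/idP => [/set_mem/= /negP//|H]; apply/mem_set => /=; exact/negP.
  by rewrite -natrM mulnb.
have mC := measurableC ml.
rewrite RintegralZr//; last first.
  exact: (bounded_measurable_integrable _ (bounded_measurable_indic mC)).
by rewrite Rintegral_indic// probability_setC// tl sube0 mul1r.
Qed.

End ties.

(** * A continuous penalty for near-ties *)

Lemma max0_lipschitz {R : realType} (x z : R) :
  `|Num.max 0 (1 - x) - Num.max 0 (1 - z)| <= `|x - z|.
Proof.
have := ler_norm (z - x); rewrite distrC; have := ler_norm (x - z).
set w := `|x - z| => ? ?; rewrite ler_norml !maxEle.
by case: ifPn; case: ifPn; rewrite -?ltNge => ? ?; apply/andP; split; lra.
Qed.

Lemma exists_pos_mul_le {R : realFieldType} (a e : R) : 0 <= a -> 0 < e ->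
  exists2 t, 0 < t & a * t <= e.
Proof.
move=> a0 e0; have a1 : 0 < a + 1 by rewrite ltr_wpDl.
(* The denominator [a + 1] covers the case a = 0. *)
exists (e / (a + 1)); first by rewrite divr_gt0.
by rewrite mulrA ler_pdivrMr// mulrC ler_pM2l// lerDl.
Qed.

Section tie_penalty.
Context {d : measure_display} {R : realType} {S : measurableMetricType d R}.
Variable n : nat.
Implicit Types (s : S) (y : n.-tuple S) (p : 'I_n * 'I_n) (c t : R).

Definition sample_gap p s y : R :=
  `|mdist s (tnth y p.1) - mdist s (tnth y p.2)|.

(* A continuous substitute for the number of pairs of samples equidistant
   from s, to which it decreases as c tends to infinity. *)
Definition tie_penalty c s y : R :=
  \sum_(p | p.1 != p.2) Num.max 0 (1 - c * sample_gap p s y).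

Local Notation C := (#|[pred p : 'I_n * 'I_n | p.1 != p.2]|%:R : R).

Lemma tie_penalty_ge0 c s y : 0 <= tie_penalty c s y.
Proof. by apply: sumr_ge0 => p _; rewrite le_max lexx. Qed.

Lemma tie_penalty_le c s y : 0 <= c -> tie_penalty c s y <= C.
Proof.
move=> c0; rewrite -sumr_const; apply: ler_sum => p _.
by rewrite ge_max ler01 lerBlDr lerDl mulr_ge0// normr_ge0.
Qed.

Lemma mdist_close t s s' (x x' : S) : mdist s s' < t -> mdist x x' < t ->
  `|mdist s x - mdist s' x'| <= 2 * t.
Proof.
move=> ss' xx'.
have h1 : mdist s x <= mdist s s' + (mdist s' x' + mdist x x').
  rewrite (le_trans (metric_triangle s s' x))// lerD2l (metric_sym x x').
  exact: metric_triangle.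
have h2 : mdist s' x' <= mdist s s' + (mdist s x + mdist x x').
  rewrite (le_trans (metric_triangle s' s x'))// (metric_sym s' s) lerD2l.
  exact: metric_triangle.
move: ss' xx' h1 h2; set a := mdist s s'; set b := mdist x x'.
set e := mdist s x; set f := mdist s' x' => *.
by rewrite ler_norml; apply/andP; split; lra.
Qed.

Lemma sample_gap_close t p s s' y y' : mdist s s' < t -> tuple_close t y y' ->
  `|sample_gap p s y - sample_gap p s' y'| <= 4 * t.
Proof.
move=> ss' yy'; rewrite (le_trans (ler_dist_dist _ _))//.
have := mdist_close ss' (yy' p.1); have := mdist_close ss' (yy' p.2).
set a := mdist s _; set b := mdist s' _; set e := mdist s _; set f := mdist s' _.
rewrite !ler_norml => /andP[? ?] /andP[? ?].
by apply/andP; split; lra.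
Qed.

Lemma tie_penalty_close c t s s' y y' : 0 <= c ->
  mdist s s' < t -> tuple_close t y y' ->
  `|tie_penalty c s y - tie_penalty c s' y'| <= C * (c * (4 * t)).
Proof.
move=> c0 ss' yy'; rewrite /tie_penalty -sumrB (le_trans (ler_norm_sum _ _ _))//.
rewrite mulr_natl -sumr_const; apply: ler_sum => p _.
have := sample_gap_close p ss' yy'.
set u := sample_gap p s y; set v := sample_gap p s' y' => uv.
by rewrite (le_trans (max0_lipschitz _ _))// -mulrBr normrM (ger0_norm c0) ler_wpM2l.
Qed.

Lemma tie_penalty_uniformly_continuous c : 0 <= c ->
  forall e : R, 0 < e -> exists2 t : R, 0 < t &
    forall s s' y y', mdist s s' < t -> tuple_close t y y' ->
      `|tie_penalty c s y - tie_penalty c s' y'| <= e.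
Proof.
move=> c0 e e0.
have [||t t0 te] := @exists_pos_mul_le R (C * (c * 4)) e; rewrite ?mulr_ge0 ?ler0n//.
exists t => // s s' y y' ss' yy'; apply: le_trans (tie_penalty_close c0 ss' yy') _.
by move: te; rewrite !mulrA.
Qed.

(** Distances move by at most 2t, so a reversal of order forces a gap of at most 4t on both sides.
    The summand of the pair (a, b) is then at least 1 - 4ct, which makes both cutoffs small. *)
Lemma tie_penalty_of_swap c t s s' y y' (a b : 'I_n) : 0 <= c ->
  mdist s s' < t -> tuple_close t y y' ->
  mdist s (tnth y a) <= mdist s (tnth y b) ->
  mdist s' (tnth y' b) < mdist s' (tnth y' a) ->
  Num.max 0 (1 - tie_penalty c s y) <= c * (4 * t) /\
  Num.max 0 (1 - tie_penalty c s' y') <= c * (4 * t).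
Proof.
move=> c0 ss' yy' ab ba.
have t0 : 0 <= t by exact: le_trans (mdist_ge0 s s') (ltW ss').
have nab : (a, b).1 != (a, b).2.
  by apply/eqP => /= eab; move: ba; rewrite eab ltxx.
have pen s0 (y0 : n.-tuple S) : sample_gap (a, b) s0 y0 <= 4 * t ->
    Num.max 0 (1 - tie_penalty c s0 y0) <= c * (4 * t).
  move=> gap; have cg := ler_wpM2l c0 gap.
  rewrite ge_max !mulr_ge0//= lerBlDl -lerBlDr.
  rewrite /tie_penalty (bigD1 (a, b))//= ler_wpDr//.
    by apply: sumr_ge0 => p _; rewrite le_max lexx.
  by rewrite le_max lerD2l lerN2 cg orbT.
have := mdist_close ss' (yy' a); have := mdist_close ss' (yy' b).
move: ab ba pen; rewrite /sample_gap/= => ab ba pen; move: ab ba.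
set da := mdist s (tnth y a); set db := mdist s (tnth y b).
set da' := mdist s' (tnth y' a); set db' := mdist s' (tnth y' b).
rewrite !ler_norml => ab ba /andP[? ?] /andP[? ?].
by split; apply: pen; rewrite ler_norml -/da -/db -/da' -/db'; apply/andP; split; lra.
Qed.

Hypothesis S_borel : borel_space S.
Hypothesis S_compact : compact [set: S].

Lemma bounded_measurable_tie_penalty c : 0 <= c ->
  bounded_measurable (fun z : S * n.-tuple S => tie_penalty c z.1 z.2).
Proof.
move=> c0; apply: bounded_measurable_sum => p.
apply: (@bounded_measurable_between _ _ _ 0 1).
  apply: measurable_maxr => //; apply: measurable_funB => //.
  apply: measurable_funM => //; apply: measurableT_comp => //.
  by apply: measurable_funB; exact: measurable_sample_dist.
by move=> z; rewrite le_max lexx/= ge_max ler01 lerBlDr lerDl mulr_ge0// normr_ge0.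
Qed.

Lemma tie_penalty_cvg0 s y : no_tie s y -> tie_penalty m%:R s y @[m --> \oo] --> (0 : R).
Proof.
rewrite no_tieE => /'forall_'forall_implyP nt.
have -> : 0 = \sum_(p : 'I_n * 'I_n | p.1 != p.2) 0 :> R by rewrite big1.
apply: cvg_big => [|p pp]; first exact: add_continuous.
(* Each summand is eventually 0, namely once m times the gap reaches 1. *)
apply: cvg_near_cst; near=> m.
have gap0 : 0 < sample_gap p s y by rewrite normr_gt0 subr_eq0 nt.
apply/max_idPl; rewrite subr_le0 -ler_pdivrMr// div1r.
near: m; exact: nbhs_infty_ger.
Unshelve. all: by end_near. Qed.

(** Dominated convergence twice: over the samples for each s outside the exceptional set [N], then
    over s, where [N] is null for [mu] by absolute continuity. *)
Lemma Rintegral_tie_penalty_cvg0 (theta mu : probability S R) :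
  {ae theta, forall s : S, nonatomic (pushforward theta (mdist s))} ->
  (forall A, measurable A -> theta A = 0%E -> mu A = 0%E) ->
  (\int[mu]_s \int[iid theta n]_y tie_penalty m%:R s y) @[m --> \oo] --> (0 : R).
Proof.
move=> [N [mN thN nN]] ac.
have bt m := bounded_measurable_tie_penalty (ler0n R m).
have abs_le m s y : `|tie_penalty m%:R s y| <= C.
  by rewrite ger0_norm ?tie_penalty_le// tie_penalty_ge0.
apply: (@bounded_cvg0_Rintegral _ _ _ mu _ C N) => //.
- by move=> m; exact: (bounded_measurable_Rintegral _ (bt m)).
- move=> m s; rewrite ler_norml; apply: Rintegral_between.
    exact: (bounded_measurable_xsection (bt m) s).
  by move=> y; rewrite -ler_norml.
- exact: ac.
- move=> s Ns.
  have na : nonatomic (pushforward theta (mdist s)).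
    by apply: contrapT => nas; apply: Ns; exact: nN.
  have mt := measurable_tie S_borel (n := n) s.
  apply: (@bounded_cvg0_Rintegral _ _ _ _ _ C [set y | ~~ no_tie s y]) => //.
  + by move=> m; exact: (bounded_measurable_xsection (bt m) s).
  + rewrite -[LHS]fineK ?fin_num_measure//; congr EFin.
    have -> : [set y | ~~ no_tie s y] = ~` [set y : n.-tuple S | no_tie s y].
      by apply/seteqP; split => y /= /negP.
    have mnt : measurable [set y : n.-tuple S | no_tie s y].
      rewrite -[X in measurable X]setCK; apply: measurableC.
      by rewrite (_ : ~` _ = [set y | ~~ no_tie s y])//;
        apply/seteqP; split => y /= /negP.
    rewrite probability_setC// fineB// ?fin_num_measure// -Rintegral_indic//=.
    rewrite -(nonatomic_no_tie S_borel n na); apply/eqP; rewrite subr_eq0; apply/eqP.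
    apply: eq_Rintegral => y _; rewrite indicE; congr (_%:R); congr nat_of_bool.
    by apply/idP/idP => [?|/set_mem//]; exact/mem_set.
  + by move=> y /= /negP; rewrite negbK; exact: tie_penalty_cvg0.
Qed.

End tie_penalty.

(** * Smoothing one step of the chain *)

Section weak_step.
Context {d : measure_display} {R : realType} {S : measurableMetricType d R}.
Variables (j k : nat).
Hypothesis jk : (j.-1 < k)%N.
Hypothesis S_borel : borel_space S.
Hypothesis S_compact : compact [set: S].
Implicit Types (c t : R) (s : S) (y : k.-tuple S).

(** At a tie the penalty is at least 1, so the cutoff factor vanishes where [step_mean] may jump. *)
Definition smoothed_step_mean c (f : S -> R) s y : R :=
  step_mean j f s y * Num.max 0 (1 - tie_penalty c s y).

Let C : R := #|[pred p : 'I_k * 'I_k | p.1 != p.2]|%:R.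

Let step_mean_bounded (f : S -> R) (M : R) s y :
  (forall x, `|f x| <= M) -> `|step_mean j f s y| <= M.
Proof.
by move=> fM; rewrite ler_norml; apply: step_mean_between => // i; rewrite -ler_norml.
Qed.

(** With u >= 0 the penalty, 1 - max(0, 1 - u) = min(1, u) <= u. *)
Lemma smoothed_step_mean_error c f (M : R) s y : (forall x, `|f x| <= M) ->
  `|step_mean j f s y - smoothed_step_mean c f s y| <= M * tie_penalty c s y.
Proof.
move=> fM; rewrite /smoothed_step_mean -[X in `|X - _|]mulr1 -mulrBr normrM.
apply: ler_pM => //; first exact: step_mean_bounded.
have := tie_penalty_ge0 c s y; set u := tie_penalty c s y => u0.
by rewrite ler_norml maxEle; case: ifPn; rewrite -?ltNge => ?; apply/andP; split; lra.
Qed.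

(** Either all comparisons of distances agree at the two points and [step_mean_near] applies, or
    some pair changes order and both cutoffs are small. *)
Lemma smoothed_step_mean_uniformly_continuous c f : 0 <= c -> continuous f ->
  forall e : R, 0 < e -> exists2 t : R, 0 < t &
    forall s s' y y', mdist s s' < t -> tuple_close t y y' ->
      `|smoothed_step_mean c f s y - smoothed_step_mean c f s' y'| <= e.
Proof.
move=> c0 cf e e0.
have [_ [M0 fM0]] := continuous_bounded_measurable S_borel S_compact cf.
pose M := `|M0|; have M0' : 0 <= M by exact: normr_ge0.
have fM x : `|f x| <= M by rewrite (le_trans (fM0 x))// ler_norm.
have e20 : 0 < e / 2 by rewrite divr_gt0.
have [t1 t10 t1f] := compact_uniformly_continuous S_compact cf e20.
(* [C] accounts for the variation of the cutoff in the first case, 2 for the two small values in the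
   second. *)
have K0 : 0 <= M * (C + 2) * (c * 4) by rewrite !mulr_ge0// addr_ge0// ler0n.
have [t2 t20 t2e] := exists_pos_mul_le K0 e20.
pose t := Num.min t1 t2.
have t0 : 0 < t by rewrite lt_min t10.
have te : M * (C * (c * (4 * t))) + M * (2 * (c * (4 * t))) <= e / 2.
  rewrite (_ : _ + _ = M * (C + 2) * (c * 4) * t); last by ring.
  by rewrite (le_trans _ t2e)// ler_wpM2l// ge_min lexx orbT.
have Cct : 0 <= M * (C * (c * (4 * t))).
  by rewrite !mulr_ge0 ?ler0n// ltW.
have ct : 0 <= M * (2 * (c * (4 * t))) by rewrite !mulr_ge0// ltW.
exists t => // s s' y y' ss' yy'; rewrite /smoothed_step_mean.
have hm := step_mean_bounded s y fM; have hm' := step_mean_bounded s' y' fM.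
set m := step_mean j f s y in hm *; set m' := step_mean j f s' y' in hm' *.
have chi01 s0 (y0 : k.-tuple S) : 0 <= Num.max 0 (1 - tie_penalty c s0 y0) <= 1.
  by rewrite le_max lexx/= ge_max ler01 gerBl tie_penalty_ge0.
have [/forallP same|] := boolP [forall a, forall b,
    (mdist s (tnth y a) <= mdist s (tnth y b)) ==
    (mdist s' (tnth y' a) <= mdist s' (tnth y' b))].
  have mm' : `|m - m'| <= e / 2.
    apply: step_mean_near => // [a b|i]; first by have /forallP/(_ b)/eqP := same a.
    by apply/ltW/t1f; rewrite (lt_le_trans (yy' i))// ge_min lexx.
  have := max0_lipschitz (tie_penalty c s y) (tie_penalty c s' y').
  have := tie_penalty_close c0 ss' yy'; rewrite -/C.
  have := chi01 s y; set x := Num.max 0 _; set x' := Num.max 0 _ => /andP[x0 x1] pp xx'.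
  have -> : m * x - m' * x' = (m - m') * x + m' * (x - x') by ring.
  rewrite (le_trans (ler_normD _ _))// [leRHS]splitr lerD//.
    by rewrite normrM (ger0_norm x0) (le_trans _ mm')// ler_piMr.
  rewrite normrM; apply: le_trans te.
  apply: (@le_trans _ _ (M * (C * (c * (4 * t))))); last by rewrite lerDl.
  by apply: ler_pM => //; exact: le_trans xx' pp.
move=> /forallPn[a /forallPn[b ab]].
have [h1 h2] : Num.max 0 (1 - tie_penalty c s y) <= c * (4 * t) /\
    Num.max 0 (1 - tie_penalty c s' y') <= c * (4 * t).
  (* The disagreement may go either way; in the second case the two configurations exchange
     roles. *)
  have [l1|l1] := leP (mdist s (tnth y a)) (mdist s (tnth y b)).
    apply: (tie_penalty_of_swap c0 ss' yy' l1); rewrite ltNge.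
    by move: ab; rewrite l1; case: (_ <= _).
  have l2 : mdist s' (tnth y' a) <= mdist s' (tnth y' b).
    by move: ab; rewrite leNgt l1 /=; case: (_ <= _).
  have ss'' : mdist s' s < t by rewrite metric_sym.
  have yy'' : tuple_close t y' y by move=> i; rewrite metric_sym.
  by have [? ?] := tie_penalty_of_swap c0 ss'' yy'' l2 l1.
have /andP[x0 _] := chi01 s y; have /andP[x0' _] := chi01 s' y'.
apply: le_trans (ler_normB _ _) _; rewrite (normrM m) (normrM m').
rewrite (ger0_norm x0) (ger0_norm x0').
apply: le_trans
  (lerD (ler_pM (normr_ge0 _) x0 hm h1) (ler_pM (normr_ge0 _) x0' hm' h2)) _.
rewrite (_ : _ + _ = M * (2 * (c * (4 * t)))); last by ring.
have e2 : e / 2 <= e by lra.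
by apply: le_trans e2; apply: le_trans te; rewrite lerDr.
Qed.

End weak_step.

(** * Continuity of the stationary distribution *)

Section continuity.
Context {d : measure_display} {R : realType} {S : measurableMetricType d R}.
Variables (j k : nat).
Hypothesis jk : (j.-1 < k)%N.
Hypothesis S_borel : borel_space S.
Hypothesis S_compact : compact [set: S].
Implicit Types (theta mu nu : probability S R).

Local Notation K := (chain_mean j k).

(** The complement of a theta-null set contains all the samples almost surely, so from every state
    one step leads there with probability 1, whatever [mu] is. *)
Lemma transports_absolutely_continuous theta mu nu : transports (K theta) mu nu ->
  forall A, measurable A -> theta A = 0%E -> nu A = 0%E.
Proof.
move=> tr A mA tA; have mC := measurableC mA.
have bC := bounded_measurable_indic (R := R) mC.
have bK := bounded_measurable_chain_mean jk S_borel S_compact theta bC.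
have : 1 <= fine (nu (~` A)).
  rewrite -Rintegral_indic// tr// -[leLHS](Rintegral_cst1 mu).
  apply: le_Rintegral_bounded => //; first exact: bounded_measurable_cst.
  move=> s; have C01 x : (~` A) x -> 1 <= (\1_(~` A) x : R).
    by move=> Cx; rewrite indicE mem_set.
  have C0 x : 0 <= (\1_(~` A) x : R) by rewrite indicE.
  have := @chain_mean_ge _ _ _ _ _ jk S_borel S_compact theta (~` A) (\1_(~` A)) 0 1 s
    mC bC ler01 C0 C01.
  by rewrite probability_setC// tA sube0 expr1n subr0 mulr1 add0r.
rewrite probability_setC// fineB ?fin_num_measure//= => h.
apply/eqP; rewrite eq_le measure_ge0 andbT -[leLHS]fineK ?fin_num_measure// lee_fin.
lra.
Qed.

(** The induction step in time. Smoothing costs at most M times the mean penalty; that mean is small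
    in the limit and, the penalty being uniformly continuous itself, also for large n. *)
Lemma transports_weakly_converges (theta_ mu_ nu_ : nat -> probability S R) theta mu nu :
  {ae theta, forall s : S, nonatomic (pushforward theta (mdist s))} ->
  (forall A, measurable A -> theta A = 0%E -> mu A = 0%E) ->
  weakly_converges theta_ theta -> weakly_converges mu_ mu ->
  (forall n, transports (K (theta_ n)) (mu_ n) (nu_ n)) ->
  transports (K theta) mu nu ->
  weakly_converges nu_ nu.
Proof.
move=> na ac wtheta wmu tr_ tr; apply/weakly_convergesP => // f cf.
have bf := continuous_bounded_measurable S_borel S_compact cf.
have [_ [M0 fM0]] := bf.
pose M := `|M0| + 1; have M_gt0 : 0 < M by rewrite ltr_wpDl.
have fM x : `|f x| <= M.
  by rewrite (le_trans (fM0 x))// (le_trans (ler_norm _))// lerDl.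
rewrite tr//; under eq_fun do rewrite tr_//.
apply/cvgrPdist_le => /= e e0.
(* Smoothing costs M e' at the limit and 2 M e' at n, and the smoothed means differ by e'; the total
   is at most [e]. *)
pose e' := e / (4 * M + 1).
have M41 : 0 < 4 * M + 1 by rewrite addr_gt0// mulr_gt0.
have e'0 : 0 < e' by rewrite divr_gt0.
have e'E : 4 * (M * e') + e' = e.
  by rewrite mulrA -[X in _ + X]mul1r -mulrDl mulrC divfK// gt_eqF.
have e'_le : M * e' + (e' + M * (e' + e')) <= e.
  by rewrite -[leRHS]e'E mulrDr; have := mulr_ge0 (ltW M_gt0) (ltW e'0); lra.
have [m pm] : exists m, `|0 - \int[mu]_s \int[iid theta k]_y tie_penalty m%:R s y| <= e'.
  have /cvgrPdist_le/(_ _ e'0)/filter_ex[m ?] :=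
    Rintegral_tie_penalty_cvg0 k S_borel S_compact na ac.
  by exists m.
pose c : R := m%:R; have c0 : 0 <= c by exact: ler0n.
have bp := bounded_measurable_tie_penalty k S_borel S_compact c0.
have bs : bounded_measurable (fun z : S * k.-tuple S => step_mean j f z.1 z.2).
  exact: bounded_measurable_step_mean.
have bF : bounded_measurable (fun z : S * k.-tuple S => smoothed_step_mean j c f z.1 z.2).
  apply: bounded_measurableM => //.
  apply: (@bounded_measurable_between _ _ _ 0 1).
    apply: measurable_maxr => //; apply: measurable_funB => //; exact: bp.1.
  by move=> z; rewrite le_max lexx/= ge_max ler01 gerBl tie_penalty_ge0.
have err (th la : probability S R) : `|\int[la]_s K th f s -
    \int[la]_s \int[iid th k]_y smoothed_step_mean j c f s y| <=
    M * \int[la]_s \int[iid th k]_y tie_penalty c s y.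
  rewrite -(Rintegral_prod la (iid th k) bs) -(Rintegral_prod la (iid th k) bF).
  rewrite -(Rintegral_prod la (iid th k) bp) -RintegralB_bounded//.
  have bMp := bounded_measurableM (bounded_measurable_cst M) bp.
  rewrite -RintegralZl//; last exact: bounded_measurable_integrable.
  rewrite ler_norml -[- _]mulN1r -RintegralZl//; last first.
    exact: bounded_measurable_integrable.
  have bMp' := bounded_measurableM (bounded_measurable_cst (-1)) bMp.
  have bd := bounded_measurableB bs bF.
  apply/andP; split; apply: le_Rintegral_bounded => // z;
    have := smoothed_step_mean_error jk c z.1 z.2 fM; rewrite ler_norml => /andP[? ?] //.
  by rewrite mulN1r.
have /cvgrPdist_le/(_ _ e'0) cvgF := Rintegral_product_cvg S_borel S_compact wtheta wmu bF
  (smoothed_step_mean_uniformly_continuous jk S_borel S_compact c0 cf).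
have /cvgrPdist_le/(_ _ e'0) cvgp := Rintegral_product_cvg S_borel S_compact wtheta wmu bp
  (tie_penalty_uniformly_continuous k c0).
apply: filter_app cvgF; move: cvgp; apply: filterS => n pn Fn.
have p0 : \int[mu]_s \int[iid theta k]_y tie_penalty c s y <= e'.
  by move: pm; rewrite sub0r normrN; apply: le_trans; exact: ler_norm.
(* The level [c] was chosen for the limit alone; convergence of the mean penalty carries the bound
   to large n. *)
have p1 : \int[mu_ n]_s \int[iid (theta_ n) k]_y tie_penalty c s y <= e' + e'.
  by rewrite (le_trans (ler_distlCDr pn))// lerD2r.
have {}err0 := le_trans (err theta mu) (ler_wpM2l (ltW M_gt0) p0).
have {}errn := le_trans (err (theta_ n) (mu_ n)) (ler_wpM2l (ltW M_gt0) p1).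
apply: le_trans (ler_distD _ _ _) (le_trans (lerD err0
  (le_trans (ler_distD _ _ _) (lerD Fn _))) _).
  by rewrite distrC; exact: errn.
exact: e'_le.
Qed.

End continuity.

Theorem proposition2 (d : measure_display) (R : realType)
    (S : measurableMetricType d R)
    (S_compact : compact [set: S]) (S_borel : borel_space S)
    (j k : nat) (k_ge2 : (2 <= k)%N) (j_ge1 : (1 <= j)%N) (j_le_k : (j <= k)%N)
    (theta : probability S R)
    (theta_nonatomic :
      {ae theta, forall s : S, nonatomic (pushforward theta (mdist s))}) :
  forall theta_ : nat -> probability S R,
    weakly_converges theta_ theta ->
    weakly_converges (fun n => pi_jk j k (theta_ n)) (pi_jk j k theta).
Proof.
move=> theta_ wtheta.
have jk : (j.-1 < k)%N by rewrite prednK.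
have bK th h := @bounded_measurable_chain_mean _ _ _ _ _ jk S_borel S_compact th h.
have [nxt nxtE] := choice (fun p : probability S R * probability S R =>
  chain_transportsE jk S_borel S_compact p.1 p.2).
(* The chain starts from [th] itself, so at time 0 both weak convergence and absolute continuity are
   immediate. *)
pose law (th : probability S R) m := iter m (fun mu => nxt (th, mu)) th.
have lawE th m : transports (chain_mean j k th) (law th m) (law th m.+1).
  exact: (nxtE (th, law th m)).
have law_cvg m : weakly_converges (fun n => law (theta_ n) m) (law theta m) /\
    forall A, measurable A -> theta A = 0%E -> law theta m A = 0%E.
  elim: m => [|m [wm acm]]; first by [].
  split; last first.
    exact: (transports_absolutely_continuous jk S_borel S_compact (lawE theta m)).
  exact: (transports_weakly_converges jk S_borel S_compact theta_nonatomic acm wtheta wm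
    (fun n => lawE (theta_ n) m) (lawE theta m)).
apply/weakly_convergesP => // f cf.
have bf := continuous_bounded_measurable S_borel S_compact cf.
have [_ [M fM]] := bf.
have fMM x : - M <= f x <= M by rewrite -ler_norml.
pose q : R := 1 - 2^-1 ^+ k.+1.
have q01 : 0 <= q < 1 by exact: pow_half_bounds.
(* The stationary law is the constant sequence of laws; the rate [q] depends on k only, hence is the
   same for all [theta_ n]. *)
have close th m :
    `|\int[pi_jk j k th]_x f x - \int[law th m]_x f x| <= q ^+ m * (M - - M).
  apply: (transports_cvg (bK th) (@chain_mean_osc _ _ _ _ _ jk S_borel S_compact th)
    (mu_ := fun=> pi_jk j k th) (nu_ := law th)) => // _.
  exact: pi_jk_transports.
have qM : q ^+ m * (M - - M) @[m --> \oo] --> (0 : R).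
  rewrite -[X in _ --> X](mul0r (M - - M)); apply: cvgMl.
  by apply: cvg_expr; have /andP[q0 q1] := q01; rewrite ger0_norm.
apply/cvgrPdist_le => /= e e0.
have e30 : 0 < e / 3 by rewrite divr_gt0.
(* The time [m] is fixed before n. Passing from the stationary laws to the laws at time [m] costs
   e/3 twice, and weak convergence at time [m] the last third. *)
have [m qm] : exists m, q ^+ m * (M - - M) <= e / 3.
  have /cvgrPdist_le/(_ _ e30)/filter_ex[m] := qM.
  by rewrite sub0r normrN => h; exists m; exact: le_trans (ler_norm _) h.
have [/weakly_convergesP - /(_ S_borel S_compact f cf)] := law_cvg m.
move=> /cvgrPdist_le/(_ _ e30) + _; apply: filterS => n fn.
rewrite (_ : e = e / 3 + (e / 3 + e / 3)); last by lra.
apply: le_trans (ler_distD _ _ _) (lerD (le_trans (close theta m) qm)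
  (le_trans (ler_distD _ _ _) (lerD fn _))).
by rewrite distrC; exact: le_trans (close (theta_ n) m) qm.
Qed.
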